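(* Let $n>1$, let $M$ be the Hardy-Littlewood maximal operator on $\mathbb{R}^n$ (centred or non-centred), and let $u \in \mathrm{BV}(\mathbb{R}^n)$, with $|\nabla u|$ denoting the total variation measure of the distributional gradient of $u$. Let $$A = \Big\{x \in \mathbb{R}^{n} : \liminf_{\delta \to 0} \int_{B(x,\delta)} M|\nabla u| \, dy = \infty \Big\}.$$ Then for each $i \in \{1,\ldots,n\}$ the distributional partial derivative $\partial_i Mu$ is represented by a function $h_i \in L^{1,\infty}(\mathbb{R}^{n})$ when acting on smooth functions with compact support not meeting $A$, that is, $$-\int_{\mathbb{R}^n} Mu \; \partial_i \varphi \, dx = \int_{\mathbb{R}^n} h_i \, \varphi \, dx$$ for all $\varphi \in C_0^\infty(\mathbb{R}^n)$ with $\operatorname{supp}\varphi \cap A = \varnothing$. Moreover, there is a constant $C$ depending only on $n$ such that $$|h_i| \leq C\, M|\nabla u| \quad \text{almost everywhere}, \quad i \in \{1,\ldots,n\}.$$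
   Context: $\mathrm{BV}(\mathbb{R}^n)$ is the space of $u \in L^1(\mathbb{R}^n)$ whose distributional gradient is a finite vector-valued Radon measure. Cubes are open with sides parallel to the coordinate axes. The non-centred Hardy-Littlewood maximal function of $f \in L^1_{loc}(\mathbb{R}^n)$ is $Mf(x) = \sup_{Q \ni x} \frac{1}{|Q|}\int_Q |f|\,dy$, supremum over all cubes $Q$ containing $x$; the centred one uses only cubes centred at $x$. For a positive Borel measure $\mu$, $M\mu(x) = \sup_Q \frac{\mu(Q)}{|Q|}$ over the same family of cubes. $B(x,\delta)$ is the open ball with centre $x$ and radius $\delta$. $L^{1,\infty}(\mathbb{R}^n)$ is the space of measurable functions $f$ with $\sup_{\lambda>0} \lambda\, |\{x \in \mathbb{R}^n : |f(x)|>\lambda\}| < \infty$. *)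

(* Defs.v *)
From HB Require Import structures.
From mathcomp Require Import all_boot all_order all_algebra.
From mathcomp Require Import all_classical all_reals all_analysis.
From mathcomp Require Import measurable_realfun.

Set Implicit Arguments.
Unset Strict Implicit.
Unset Printing Implicit Defensive.

Import Order.TTheory GRing.Theory Num.Theory.
Import numFieldNormedType.Exports.

Local Open Scope classical_set_scope.
Local Open Scope ring_scope.

(* 'rV[R]_n carries the Borel sigma-algebra of its topology. *)
HB.instance Definition _ (R : realType) (n : nat) :=
  @isMeasurable.Build (sigma_display (@open 'rV[R]_n)) 'rV[R]_n
    <<s @open 'rV[R]_n >> (@sigma_algebra0 _ setT _)
    (@sigma_algebraC _ (@open 'rV[R]_n)) (@sigma_algebra_bigcup _ setT _).

Section borel_rV.
Context {R : realType}.

Lemma open_measurable_rV n (U : set 'rV[R]_n) : open U -> measurable U.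
Proof. by move=> oU; exact: sub_sigma_algebra. Qed.

Lemma measurable_coord n (i : 'I_n) :
  measurable_fun [set: 'rV[R]_n] (fun x : 'rV[R]_n => x ord0 i).
Proof.
apply: (measurability _ (RGenOpens.measurableE R)).
move=> _ [_ [a [b ->] <-]]; rewrite setTI; apply: open_measurable_rV.
by apply: open_comp; [move=> x _; exact: coord_continuous|exact: interval_open].
Qed.

Lemma measurable_fun_rV d (T : measurableType d) n (f : T -> 'rV[R]_n) :
  (forall i, measurable_fun [set: T] (fun t => f t ord0 i)) ->
  measurable_fun [set: T] f.
Proof.
move=> mf; apply: (@measurability _ _ _ _ _ _ (@open 'rV[R]_n)) => //.
move=> _ [U oU <-]; rewrite setTI.
pose Q (p : 'rV[rat]_n * nat) : set 'rV[R]_n :=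
  [set x | forall i, `|ratr (p.1 ord0 i) - x ord0 i| < p.2.+1%:R^-1].
pose F p := if pselect (Q p `<=` U) then Q p else set0.
have UF : U = \bigcup_p F p.
  apply/seteqP; split=> [x Ux|x [p _]]; last first.
    by rewrite /F; case: pselect => // pU; exact: pU.
  have /nbhs_ballP[e /= e0 xeU] : nbhs x U by exact: open_nbhs_nbhs.
  have [k ke] : exists k : nat, (k.+1%:R^-1 : R) < e / 2.
    near \oo => k; exists k; near: k; apply: near_infty_natSinv_lt (PosNum _).
    by rewrite divr_gt0.
  have /choice[q qP] : forall i : 'I_n,
      exists q : rat, `|ratr q - x ord0 i| < k.+1%:R^-1.
    move=> i; have k0 : (0 : R) < k.+1%:R^-1 by rewrite invr_gt0.
    have : x ord0 i < x ord0 i + k.+1%:R^-1 by rewrite ltrDl.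
    case/rat_in_itvoo => q; rewrite inE/= => /itvP h.
    have [xq qx] : x ord0 i < ratr q /\ ratr q < x ord0 i + k.+1%:R^-1.
      by rewrite !h.
    exists q; rewrite ger0_norm ?subr_ge0 1?ltW//.
    by rewrite ltrBlDl.
  exists (\row_i q i, k) => //; rewrite /F; case: pselect => [_|]/=.
    by move=> i /=; rewrite mxE.
  case=> y yQ; apply: xeU; split => // i j; rewrite ord1.
  rewrite /ball/= -(subrK (ratr (q j)) (x ord0 j)) -addrA.
  rewrite (le_lt_trans (ler_normD _ _))// (splitr e) ltrD//.
    by rewrite distrC; exact: lt_trans (qP j) ke.
  by have := yQ j; rewrite /= mxE => /lt_trans; apply.
rewrite UF preimage_bigcup; apply: countable_bigcupT_measurable => //.
move=> p; rewrite /F; case: pselect => pU; last by rewrite preimage_set0.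
rewrite (_ : _ @^-1` _ = \bigcap_(i in [set: 'I_n])
  [set t | `|ratr (p.1 ord0 i) - f t ord0 i| < p.2.+1%:R^-1]).
  apply: fin_bigcap_measurable => // i _.
  pose g (t : T) := `|ratr (p.1 ord0 i) - f t ord0 i|.
  have mg : measurable_fun setT g.
    by apply: measurableT_comp => //; exact: measurable_funB.
  rewrite -[X in measurable X]setTI.
  rewrite (_ : [set t | _] = g @^-1` `]-oo, p.2.+1%:R^-1[%classic); first exact: mg.
  by apply/seteqP; split => t /=; rewrite in_itv.
by apply/seteqP; split => t /= h i; [move=> _|]; exact: h.
Unshelve. all: by end_near. Qed.

Definition rV_rcons n (p : 'rV[R]_n * R) : 'rV[R]_n.+1 :=
  \row_i if unlift ord_max i is Some j then p.1 ord0 j else p.2.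

Lemma measurable_rV_rcons n : measurable_fun [set: 'rV[R]_n * R] (@rV_rcons n).
Proof.
apply: measurable_fun_rV => i.
case: (unliftP ord_max i) => [j ij|ij].
  rewrite (_ : (fun _ => _) = (fun x : 'rV[R]_n => x ord0 j) \o fst).
    by apply: measurableT_comp => //; exact: measurable_coord.
  by apply/funext => p; rewrite mxE ij liftK.
rewrite (_ : (fun _ => _) = snd) //.
by apply/funext => p; rewrite mxE ij unlift_none.
Qed.


Definition lebesgue_step n (m : {measure set 'rV[R]_n -> \bar R}) :=
  pushforward (m \x @lebesgue_measure R)%E (@rV_rcons n).

HB.instance Definition _ n (m : {measure set 'rV[R]_n -> \bar R}) :=
  Measure.copy (lebesgue_step m)
    (measure_function_pushforward__canonical__measure_function_Measure
      (m \x @lebesgue_measure R)%E (@measurable_rV_rcons n)).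

End borel_rV.

(* Lebesgue measure on R^n: the n-fold product of the one-dimensional one. *)
Fixpoint lebesgue_rV (R : realType) (n : nat) :
    {measure set 'rV[R]_n -> \bar R} :=
  match n with
  | 0 => \d_(0 : 'rV[R]_0)
  | m.+1 => lebesgue_step (lebesgue_rV R m)
  end.

Lemma lebesgue_rV_box (R : realType) n (B : 'I_n -> set R) :
  (forall i, measurable (B i)) ->
  lebesgue_rV R n [set x | forall i, B i (x ord0 i)] =
  (\prod_(i < n) lebesgue_measure (B i))%E.
Proof.
elim: n B => [|n IHn] B mB.
  by rewrite big_ord0 /= diracE mem_set//= => -[].
pose W i := widen_ord (leqnSn n) i.
have mW : measurable [set x : 'rV[R]_n | forall i, B (W i) (x ord0 i)].
  rewrite (_ : [set _ | _] = \bigcap_(i in [set: 'I_n])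
      (fun x : 'rV[R]_n => x ord0 i) @^-1` B (W i)).
    apply: fin_bigcap_measurable => // i _.
    by rewrite -[X in measurable X]setTI; exact: measurable_coord.
  by apply/seteqP; split => x /= h i; [move=> _|]; exact: h.
rewrite big_ord_recr /= /lebesgue_step /pushforward.
rewrite (_ : _ @^-1` _ =
    [set x : 'rV[R]_n | forall i, B (W i) (x ord0 i)] `*` B ord_max).
  rewrite product_measure1E//; last exact: mB.
  congr (_ * _)%E.
  exact: (IHn (B \o W) (fun i => mB _)).
have liftE i : lift ord_max i = W i.
  by apply/val_inj; exact: lift_max.
apply/seteqP; split => [[x y]/= h|[x y]/= [hx hy] i].
  split=> [i|]; last by have := h ord_max; rewrite mxE unlift_none.
  by have := h (lift ord_max i); rewrite mxE liftK -liftE.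
rewrite mxE; case: (unliftP ord_max i) => [j ->|->] //=.
by rewrite liftE; exact: hx.
Qed.

Section smooth_functions.
Context {R : realType} {n : nat}.
Implicit Types (f : 'rV[R]_n -> R) (i : 'I_n).

Definition basis_vector i : 'rV[R]_n := delta_mx ord0 i.

Definition partial i f : 'rV[R]_n -> R := 'D_(basis_vector i) f.

Definition iter_partial (s : seq 'I_n) f : 'rV[R]_n -> R := foldr partial f s.

Definition smooth f := forall s : seq 'I_n,
  continuous (iter_partial s f) /\
  forall i x, derivable (iter_partial s f) x (basis_vector i).

Definition supp f : set 'rV[R]_n := closure [set x | f x != 0].

Definition test_function f := smooth f /\ compact (supp f).

End smooth_functions.

Section bounded_variation.
Context {R : realType} {n : nat}.
Local Open Scope ereal_scope.

Local Notation L := (lebesgue_rV R n).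

(* The norm and the balls of the library on 'rV[R]_n are those of the sup norm:
   [ball c r] is an open cube. Euclidean ones are needed besides. *)
Definition euclid_norm (v : 'rV[R]_n) : R :=
  Num.sqrt (\sum_(i < n) (v ord0 i ^+ 2))%R.

Definition euclid_ball (x : 'rV[R]_n) (r : R) : set 'rV[R]_n :=
  [set y | (euclid_norm (y - x) < r)%R].

Lemma exists_hahn_decomposition (nu : {charge set 'rV[R]_n -> \bar R}) :
  exists PN : set 'rV[R]_n * set 'rV[R]_n, hahn_decomposition nu PN.1 PN.2.
Proof. by have [P [N PN]] := Hahn_decomposition nu; exists (P, N). Qed.

(* By uniqueness of the Jordan decomposition, the value does not depend on the
   Hahn decomposition that is picked. *)
Definition charge_integral (nu : {charge set 'rV[R]_n -> \bar R})
    (f : 'rV[R]_n -> R) : \bar R :=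
  let nuPN := projT2 (cid (exists_hahn_decomposition nu)) in
  (\int[jordan_pos nuPN]_x (f x)%:E) - (\int[jordan_neg nuPN]_x (f x)%:E).

(* A finite R^n-valued Borel measure is given by its n components, which are
   finite signed measures; finite Borel measures on R^n are Radon. *)
Definition vector_measure := 'I_n -> {charge set 'rV[R]_n -> \bar R}.

Definition vector_value (nu : vector_measure) (E : set 'rV[R]_n) : 'rV[R]_n :=
  \row_i fine (nu i E).

Definition vector_variation (nu : vector_measure) (E : set 'rV[R]_n) : \bar R :=
  ereal_sup
    [set \sum_(k <oo) (euclid_norm (vector_value nu (F k)))%:E | F in
      [set F : (set 'rV[R]_n)^nat |
        [/\ forall k, measurable (F k), trivIset [set: nat] F &
            \bigcup_k F k = E]]].

Definition distributional_gradient (u : 'rV[R]_n -> R) (Du : vector_measure) :=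
  forall (i : 'I_n) (phi : 'rV[R]_n -> R), test_function phi ->
    - (\int[L]_x (u x * partial i phi x)%:E) = charge_integral (Du i) phi.

Definition BV (u : 'rV[R]_n -> R) :=
  L.-integrable [set: 'rV[R]_n] (EFin \o u) /\
  exists Du : vector_measure, distributional_gradient u Du.

End bounded_variation.
Arguments vector_measure : clear implicits.

Variant maximal_kind := Centred | NonCentred.

Section maximal_operator.
Context {R : realType} {n : nat}.
Local Open Scope ereal_scope.

Local Notation L := (lebesgue_rV R n).

Definition admissible_cube (k : maximal_kind) (x c : 'rV[R]_n) (r : R) : Prop :=
  (0 < r)%R /\ match k with Centred => c = x | NonCentred => ball c r x end.

Definition maximal_measure (k : maximal_kind) (mu : set 'rV[R]_n -> \bar R)
    (x : 'rV[R]_n) : \bar R :=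
  ereal_sup [set mu (ball q.1 q.2) / L (ball q.1 q.2) | q in
    [set q : 'rV[R]_n * R | admissible_cube k x q.1 q.2]].

Definition maximal_fun (k : maximal_kind) (f : 'rV[R]_n -> R) :
    'rV[R]_n -> \bar R :=
  maximal_measure k (fun Q => \int[L]_(y in Q) `|f y|%:E).

Definition blowup_set (g : 'rV[R]_n -> \bar R) : set 'rV[R]_n :=
  [set x | limf_einf (fun d : R => \int[L]_(y in euclid_ball x d) g y) 0^'+
           = +oo].

Definition weak_L1 (h : 'rV[R]_n -> R) :=
  measurable_fun [set: 'rV[R]_n] h /\
  ereal_sup [set t%:E * L [set x | (t < `|h x|)%R] | t in [set t : R | (0 < t)%R]]
    < +oo.

End maximal_operator.

(* Main.v *)
(* Write f = M u, g_j = M |D_j u| and e = e_i. The total variation of D_i u bounds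
   the L^1 modulus of translations of u in the direction e, and averaging this
   bound over cubes gives, for every x and s <= t,
     |f(x + t e) - f(x + s e)| <= int_s^t g_i(x + r e) dr,
   so that M u is absolutely continuous on every segment where g_i is integrable.
   The derivative h along e is cut off to be at most g_i <= M |D u| everywhere,
   whence the constant 1 and, by the weak type (1,1) of M, the membership of h in
   weak L^1. Away from A all the g_j are locally integrable; joining x to x + v by
   segments parallel to the axes and averaging over x and v then shows that M u
   is locally integrable as well, and integration by parts is Fubini's theorem
   applied to f(x + t e) - f(x) = int_0^t h(x + s e) ds, followed by t -> 0.
   M |D u| itself need not be measurable a priori: it enters only through the
   monotonicity of the integral. *)
Require Import Defs.
From HB Require Import structures.
From mathcomp Require Import all_boot all_order all_algebra.
From mathcomp Require Import all_classical all_reals all_analysis.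
From mathcomp Require Import measurable_realfun.
From mathcomp Require finmap.
From mathcomp Require Import ring lra.

Set Implicit Arguments.
Unset Strict Implicit.
Unset Printing Implicit Defensive.

Import Order.TTheory GRing.Theory Num.Theory.
Import numFieldNormedType.Exports.

Local Open Scope classical_set_scope.
Local Open Scope ring_scope.

(** * Borel sets and Lebesgue measure of R^n *)

Section boxes.
Context {R : realType} {n : nat}.
Implicit Types (a b v x : 'rV[R]_n).

(** The analysis runs on the variations of the components D_j u, each the sum of the two Jordan
    parts of a charge and hence a finite measure, so that Tonelli and covering arguments apply to
    it; |D u| returns only in the final comparison and in A. A weak gradient is known only through
    its action on test functions. Instead of mollifying u, indicators of boxes are approximated by
    smooth bumps, and measures are determined by their values on boxes: this turns the weak
    formulation into an identity between measures. A cube carried along with its point stays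
    admissible, whether centred or not. Along lines no other property of the family of cubes
    matters, so one argument serves both operators. Since u lies in L^(n/(n-1)), the Sobolev
    inequality would be another way to the local integrability of M u; paths parallel to the axes
    reuse the estimates along lines instead. *)

Definition box a b : set 'rV[R]_n :=
  [set x | forall i, a ord0 i < x ord0 i < b ord0 i].

Lemma box_set a b :
  box a b = [set x | forall i, `]a ord0 i, b ord0 i[%classic (x ord0 i)].
Proof. by apply/seteqP; split => x h i; have := h i; rewrite /= in_itv. Qed.

Lemma open_box a b : open (box a b).
Proof.
rewrite openE => x xab; apply: (@filter_forall _ _
  (fun i (y : 'rV[R]_n) => a ord0 i < y ord0 i < b ord0 i) (nbhs x) _) => i.
have : open ((fun x : 'rV[R]_n => x ord0 i) @^-1` `]a ord0 i, b ord0 i[).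
  apply: open_comp; first by move=> y _; exact: coord_continuous.
  exact: interval_open.
rewrite openE => /(_ x); rewrite /= in_itv/= => /(_ (xab i)).
by apply: filterS => y /=; rewrite in_itv.
Qed.

Lemma measurable_box a b : measurable (box a b).
Proof. by apply: open_measurable_rV; exact: open_box. Qed.

Lemma boxI a b c d :
  box a b `&` box c d =
  box (\row_i Num.max (a ord0 i) (c ord0 i)) (\row_i Num.min (b ord0 i) (d ord0 i)).
Proof.
apply/seteqP; split => [x [h1 h2] i|x h].
  by rewrite !mxE gt_max lt_min; have /andP[-> ->] := h1 i; have /andP[-> ->] := h2 i.
by split => i; have := h i; rewrite !mxE gt_max lt_min => /andP[/andP[? ?] /andP[? ?]];
  apply/andP.
Qed.

Lemma ball_box (c : 'rV[R]_n) (r : R) : 0 < r ->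
  ball c r = box (c - const_mx r) (c + const_mx r).
Proof.
move=> r0; apply/seteqP; split => [x [_ h] i|x h].
  by have := h ord0 i; rewrite /ball/= !mxE ltr_distlC.
by split => // i j; have := h j; rewrite (ord1 i) /ball/= !mxE ltr_distlC.
Qed.

Lemma measurable_ball_rV (c : 'rV[R]_n) (r : R) : measurable (ball c r).
Proof. by apply: open_measurable_rV; exact: ball_open. Qed.

Definition boxes : set (set 'rV[R]_n) := [set box p.1 p.2 | p in setT].

(** Countability enters through these rational cubes, both for generating the Borel sets by boxes
    and for extracting a sequence of cubes in the covering argument. *)
Lemma rat_ball (O : set 'rV[R]_n) x : open O -> O x ->
  exists p : 'rV[rat]_n * nat,
    let Q := ball (map_mx ratr p.1 : 'rV[R]_n) (p.2.+1%:R^-1 : R) in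
    Q x /\ Q `<=` O.
Proof.
move=> oO Ox.
have /nbhs_ballP[d /= d0 xdO] : nbhs x O by exact: open_nbhs_nbhs.
(* Half of [d], because a cube of radius 1/(j+1) through [x] is only known to stay in the cube of
   radius 2/(j+1) around [x]. *)
have [j je] : exists j : nat, (j.+1%:R^-1 < d / 2)%R.
  have d20 : (0 < d / 2)%R by rewrite divr_gt0.
  near \oo => j; exists j; near: j; exact: near_infty_natSinv_lt (PosNum d20).
have j0 : (0 < j.+1%:R^-1 :> R)%R by rewrite invr_gt0.
have /choice[q qP] : forall i : 'I_n,
    exists q : rat, (`|ratr q - x ord0 i| < j.+1%:R^-1)%R.
  move=> i; have : (x ord0 i < x ord0 i + j.+1%:R^-1)%R by rewrite ltrDl.
  case/rat_in_itvoo => q; rewrite in_itv/= => /andP[xq qx].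
  by exists q; rewrite ger0_norm ?subr_ge0 1?ltW// ltrBlDl.
have xQ : ball (map_mx ratr (\row_i q i) : 'rV[R]_n) (j.+1%:R^-1 : R) x.
  by split => // a b; rewrite (ord1 a) /ball/= !mxE.
exists (\row_i q i, j) => /=; split => //.
move=> y yQ; apply: xdO.
apply: le_ball (ball_triangle (ball_sym xQ) yQ).
by rewrite [leRHS](splitr d) lerD// ltW.
Unshelve. all: by end_near. Qed.

Lemma open_bigcup_rat_box (U : set 'rV[R]_n) : open U ->
  exists F : ('rV[rat]_n * nat) -> set 'rV[R]_n,
    (forall p, F p = set0 \/ exists a b, F p = box a b) /\ U = \bigcup_p F p.
Proof.
move=> oU.
pose Q (p : 'rV[rat]_n * nat) := ball (map_mx ratr p.1 : 'rV[R]_n) (p.2.+1%:R^-1 : R).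
exists (fun p => if pselect (Q p `<=` U) then Q p else set0); split.
  move=> p; case: pselect => pU; [right|by left].
  by rewrite /=; eexists; eexists; apply: ball_box; rewrite invr_gt0.
apply/seteqP; split=> [x Ux|x [p _]]; last by case: pselect => // pU; exact: pU.
by have [p [Qx QU]] := rat_ball oU Ux; exists p => //=; case: pselect.
Qed.

Lemma measurable_rVE : @measurable _ 'rV[R]_n = <<s boxes >>.
Proof.
apply/seteqP; split; apply: smallest_sub; try exact: smallest_sigma_algebra.
  move=> U oU; have [F [FB ->]] := open_bigcup_rat_box oU.
  apply: (@countable_bigcupT_measurable _ (g_sigma_algebraType boxes)).
    exact: countableP.
  move=> p; have [->|[a [b ->]]] := FB p; first exact: measurable0.
  by apply: sub_sigma_algebra; exists (a, b).
by move=> _ [p _ <-]; exact: measurable_box.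
Qed.

Lemma setI_closed_boxes : setI_closed boxes.
Proof. by move=> _ _ [p _ <-] [q _ <-]; rewrite boxI; eexists (_, _). Qed.

Lemma bigcup_box : \bigcup_k box (const_mx (- k%:R)) (const_mx k%:R) = [set: 'rV[R]_n].
Proof.
rewrite -subTset => x _.
have [M xM] : exists M : nat, forall i, `|x ord0 i| < M%:R.
  exists (Num.bound (\sum_i `|x ord0 i|)) => i.
  apply: le_lt_trans (_ : _ <= \sum_i `|x ord0 i|) _.
    by rewrite (bigD1 i)//= lerDl sumr_ge0.
  by rewrite archi_boundP// sumr_ge0.
by exists M => // i; rewrite !mxE -ltr_norml.
Qed.

(** Boxes are stable under intersection, generate the Borel sets and exhaust the space; with
    finiteness on boxes the pi-system argument applies. *)
Lemma rV_measure_unique (m1 m2 : {measure set 'rV[R]_n -> \bar R}) :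
  (forall a b, m1 (box a b) = m2 (box a b)) ->
  (forall a b, m1 (box a b) < +oo)%E ->
  forall A, measurable A -> m1 A = m2 A.
Proof.
move=> m12 m1oo A mA.
apply: (measure_unique boxes (fun k => box (const_mx (- k%:R)) (const_mx k%:R))) => //.
- exact: measurable_rVE.
- exact: setI_closed_boxes.
- by move=> k; eexists (_, _).
- exact: bigcup_box.
- by move=> _ [p _ <-]; exact: m12.
Qed.

End boxes.

Section lebesgue.
Context {R : realType} {n : nat}.
Local Open Scope ereal_scope.

(* [lebesgue_rV], bundled as a sigma-finite measure as Fubini's theorem needs. *)
Definition leb : set 'rV[R]_n -> \bar R := lebesgue_rV R n.

HB.instance Definition _ := Measure.on leb.

Lemma leb_box (a b : 'rV[R]_n) : leb (box a b) =
  (\prod_(i < n) if (a ord0 i < b ord0 i)%R then b ord0 i - a ord0 i else 0)%:E.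
Proof.
rewrite box_set /leb.
rewrite (lebesgue_rV_box (B := fun i => `]a ord0 i, b ord0 i[%classic)); last first.
  by move=> i; exact: measurable_itv.
rewrite -prodEFin; apply: eq_bigr => i _.
by rewrite lebesgue_measure_itv/= lte_fin; case: ifP.
Qed.

Lemma leb_box_lty (a b : 'rV[R]_n) : leb (box a b) < +oo.
Proof. by rewrite leb_box ltry. Qed.

Let leb_sigma_finite : sigma_finite setT leb.
Proof.
exists (fun k => box (const_mx (- k%:R)%R) (const_mx k%:R%R) : set 'rV[R]_n).
  by rewrite bigcup_box.
by move=> k; split; [exact: measurable_box|exact: leb_box_lty].
Qed.

HB.instance Definition _ := Measure_isSigmaFinite.Build _ _ _ leb leb_sigma_finite.

Lemma leb_ball (c : 'rV[R]_n) (r : R) : (0 < r)%R ->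
  leb (ball c r) = ((r *+ 2) ^+ n)%:E.
Proof.
move=> r0; rewrite ball_box// leb_box; congr EFin.
rewrite (eq_bigr (fun=> r *+ 2)%R) ?prodr_const ?card_ord// => i _.
by rewrite !mxE ltrD2l gtrN// opprD opprK addrACA subrr add0r mulr2n.
Qed.

Lemma measurable_addrV d (T : measurableType d) (f g : T -> 'rV[R]_n) :
  measurable_fun setT f -> measurable_fun setT g ->
  measurable_fun setT (fun x => f x + g x)%R.
Proof.
move=> mf mg; apply: measurable_fun_rV => i.
under eq_fun do rewrite mxE.
by apply: measurable_funD; [exact: (measurableT_comp (measurable_coord i) mf)|
  exact: (measurableT_comp (measurable_coord i) mg)].
Qed.

Lemma measurable_scalerV d (T : measurableType d) (f : T -> R) (v : 'rV[R]_n) :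
  measurable_fun setT f -> measurable_fun setT (fun x => f x *: v)%R.
Proof.
move=> mf; apply: measurable_fun_rV => i.
under eq_fun do rewrite mxE.
by apply: measurable_funM.
Qed.

Lemma measurable_translation (v : 'rV[R]_n) :
  measurable_fun setT (fun x : 'rV[R]_n => x + v)%R.
Proof. exact: measurable_addrV. Qed.

Lemma leb_translation (v : 'rV[R]_n) (A : set 'rV[R]_n) : measurable A ->
  leb [set x | A (x + v)%R] = leb A.
Proof.
move=> mA.
pose m1 := pushforward leb (fun x : 'rV[R]_n => x + v)%R.
pose m1m : {measure set 'rV[R]_n -> \bar R} := 
  measure_function_pushforward__canonical__measure_function_Measure
      leb (measurable_translation v).
have m1box a b : m1m (box a b) = leb (box a b).
  rewrite /m1m /= /m1 /pushforward (_ : _ @^-1` _ = box (a - v) (b - v))%R.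
    rewrite !leb_box; congr EFin; apply: eq_bigr => i _.
    by rewrite !mxE ltrD2r opprD opprK addrACA addNr addr0.
  by apply/seteqP; split => x h i; have := h i; rewrite !mxE ltrBlDr ltrBrDr.
apply: (@rV_measure_unique _ _ m1m leb) => // a b; rewrite ?m1box//.
exact: leb_box_lty.
Qed.

Lemma ge0_integral_translation (v : 'rV[R]_n) (f : 'rV[R]_n -> \bar R) :
  measurable_fun setT f -> (forall x, 0 <= f x) ->
  \int[leb]_x f (x + v)%R = \int[leb]_x f x.
Proof.
move=> mf f0.
transitivity (\int[pushforward leb (fun x : 'rV[R]_n => x + v)%R]_x f x).
  by rewrite (ge0_integral_pushforward (measurable_translation v)).
pose m1 : {measure set 'rV[R]_n -> \bar R} :=
  measure_function_pushforward__canonical__measure_function_Measure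
      leb (measurable_translation v).
apply: (eq_measure_integral leb (m1 := m1)) => A mA _.
by rewrite /m1 /= /pushforward -[RHS](leb_translation v mA).
Qed.

Lemma integral_translation (v : 'rV[R]_n) (f : 'rV[R]_n -> \bar R) :
  measurable_fun setT f ->
  \int[leb]_x f (x + v)%R = \int[leb]_x f x.
Proof.
move=> mf; rewrite [LHS]integralE [RHS]integralE.
rewrite (_ : (fun x => f (x + v)%R) = f \o (fun x => x + v)%R)//.
rewrite funepos_comp funeneg_comp.
rewrite (ge0_integral_translation v (f := f^\+))//; last first.
  exact: measurable_funepos.
rewrite (ge0_integral_translation v (f := f^\-))//.
exact: measurable_funeneg.
Qed.

Lemma integrable_translation (v : 'rV[R]_n) (f : 'rV[R]_n -> \bar R) :
  leb.-integrable setT f -> leb.-integrable setT (fun x => f (x + v))%R.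
Proof.
move=> /integrableP[mf foo]; apply/integrableP; split.
  by apply: measurableT_comp => //; exact: measurable_translation.
rewrite (ge0_integral_translation v (f := fun x => `|f x|))//.
exact: measurableT_comp.
Qed.

End lebesgue.

(** * Test functions *)

Section flat_function.
Context {R : realType}.
Implicit Types (m : nat) (s : R).

(** The function exp(-1/s) extended by 0, with powers of 1/s thrown in: the derivative of a member
    of the family is then a combination of members. *)
Definition flat m s : R := if 0 < s then s^-1 ^+ m * expR (- s^-1) else 0.

Lemma flat_ge0 m s : 0 <= flat m s.
Proof.
rewrite /flat; case: ifPn => // s0.
by rewrite mulr_ge0 ?expR_ge0// exprn_ge0// invr_ge0 ltW.
Qed.

(** From y^(m+2) <= (m+2)! exp(y) at y = 1/s. Two spare powers of 1/s become [s ^+ 2], which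
    squeezes the function to 0 at the origin. *)
Lemma flat_le_sqr m s : flat m s <= (m.+2)`!%:R * s ^+ 2.
Proof.
rewrite /flat; case: ifPn => [s0|_]; last by rewrite mulr_ge0 ?sqr_ge0.
have y0 : 0 < s^-1 by rewrite invr_gt0.
have fact0 : (0 : R) < (m.+2)`!%:R by rewrite ltr0n fact_gt0.
have := expR_ge1Dxn m.+1 (ltW y0); rewrite expRN => h.
rewrite ler_pdivrMr ?expR_gt0//.
have : s^-1 ^+ m.+2 <= (m.+2)`!%:R * expR s^-1.
  rewrite -ler_pdivrMl// mulrC; apply: le_trans h; by rewrite lerDr.
have -> : s^-1 ^+ m = s^-1 ^+ m.+2 * s ^+ 2.
  by rewrite -addn2 exprD -mulrA -exprMn mulVf ?expr1n ?mulr1// gt_eqF.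
by move=> h2; rewrite [leRHS]mulrAC; apply: ler_wpM2r => //; rewrite exprn_ge0// ltW.
Qed.

Lemma is_derive_flat m s :
  is_derive s (1 : R) (flat m) (flat m.+2 s - m%:R * flat m.+1 s).
Proof.
have [s0|s0|->] := ltgtP s 0.
- rewrite /flat !ltNge (ltW s0)/= mulr0 subr0.
  have : is_derive s (1 : R) (cst 0 : R -> R) 0 by exact: is_derive_cst.
  apply: near_eq_is_derive.
  near=> x; rewrite ifF//; apply/negbTE; rewrite -leNgt ltW//.
  by near: x; exact: lt_nbhsl.
- rewrite /flat s0.
  apply: (near_eq_is_derive (f := fun s => s^-1 ^+ m * expR (- s^-1))).
    by near=> x; rewrite ifT//; near: x; exact: lt_nbhsr.
  have s_neq0 : s != 0 by rewrite gt_eqF.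
  have dV : is_derive s (1 : R) (fun x : R => x^-1) (- s ^- 2).
    by have := is_deriveV s_neq0 (is_derive_id s (1 : R)); rewrite [_ *: _]mulr1.
  have dX := is_deriveX m dV.
  have dE : is_derive s (1 : R) (fun x : R => expR (- x^-1))
      (expR (- s^-1) * s ^- 2).
    rewrite -[s ^- 2]opprK.
    exact: (is_derive1_comp (is_derive_expR _) (is_deriveN dV)).
  have := is_deriveM dX dE.
  rewrite (_ : (fun x : R => x^-1) ^+ m * _ = fun s => s^-1 ^+ m * expR (- s^-1));
    last by apply/funext => x; rewrite /= fctE exprfctE.
  congr (is_derive _ _ _ _); rewrite /= !fctE ?exprfctE /GRing.scale/=.
  rewrite -!exprVn; case: m {dX} => [|k]; first by rewrite !mul0r !mulr0; ring.
  by rewrite /= !exprS; ring.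
(* At 0 the difference quotient of [flat m] is [flat m.+1] itself, continuous there by
   [flat_le_sqr]; both terms of the claimed derivative vanish at 0. *)
- apply/is_derive1_caratheodory; exists (flat m.+1); split.
  + move=> z; rewrite [in flat m 0]/flat ltxx !subr0 /flat.
    case: ifPn => [z0|]; last by rewrite mul0r.
    have zV : z^-1 * z = 1 by rewrite mulVf// gt_eqF.
    by rewrite exprS -[LHS]mul1r -zV; ring.
  + suff : flat m.+1 z @[z --> (0 : R)] --> (0 : R).
      have flat00 : flat m.+1 0 = 0 by rewrite /flat ltxx.
      by rewrite /prop_for /continuous_at flat00.
    apply: (@squeeze_cvgr _ _ _ _ (cst 0) (fun z => (m.+3)`!%:R * z ^+ 2)).
    - by near=> z; rewrite flat_ge0 flat_le_sqr.
    - exact: cvg_cst.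
    - rewrite -[X in _ --> X](mulr0 (m.+3)`!%:R); apply: cvgMr.
      rewrite -[X in _ --> X](expr0n R 2).
      exact: (@exprn_continuous R 2 0).
  + by rewrite /flat ltxx mulr0 subrr.
Unshelve. all: by end_near. Qed.

Lemma continuous_flat m : continuous (flat m).
Proof.
move=> s; apply: differentiable_continuous; apply/derivable1_diffP.
by have [] := is_derive_flat m s.
Qed.

End flat_function.

Section smooth_bumps.
Context {R : realType} {n : nat}.

Lemma is_derive_line (V : normedModType R) (f : V -> R) (x v : V) l :
  is_derive (0 : R) (1 : R) (fun h => f (h *: v + x)) l -> is_derive x v f l.
Proof.
have E : (fun h : R => h^-1 *: (f (h *: v + x) - f x)) =
    (fun h : R => h^-1 *: (f ((h *: (1 : R) + 0) *: v + x) - f (0 *: v + x))).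
  by apply/funext => h; rewrite scale0r add0r addr0 [h *: 1]mulr1.
case=> d1 d2; split; first by rewrite /derivable /= E.
by rewrite -d2 /derive /= E.
Qed.

(** Smoothness concerns all iterated partial derivatives. This class is closed under taking them, so
    continuity and a single differentiation suffice. *)
Inductive bump_algebra : ('rV[R]_n -> R) -> Prop :=
| bump_flat m i c d : bump_algebra (fun x => flat m (c * x ord0 i + d))
| bump_cst c : bump_algebra (cst c)
| bump_add f g : bump_algebra f -> bump_algebra g -> bump_algebra (f \+ g)
| bump_mul f g : bump_algebra f -> bump_algebra g -> bump_algebra (f \* g).

Lemma bump_derive f : bump_algebra f ->
  continuous f /\ forall i, exists2 g, bump_algebra g &
    forall x, is_derive x (basis_vector i : 'rV[R]_n) f (g x).
Proof.
elim=> {f} [m i c d|c|f g _ [cf df] _ [cg dg]|f g Sf [cf df] Sg [cg dg]].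
- split.
    move=> x; apply: (@continuous_comp _ _ _ (fun x : 'rV[R]_n => c * x ord0 i + d) (flat m));
      last exact: continuous_flat.
    apply: continuousD; last exact: cst_continuous.
    by apply: continuousM; [exact: cst_continuous|exact: coord_continuous].
  move=> j; exists ((cst (c * (i == j)%:R)) \*
    ((fun x => flat m.+2 (c * x ord0 i + d)) \+
     ((cst (- m%:R)) \* (fun x => flat m.+1 (c * x ord0 i + d))))).
    by do !(constructor).
  move=> x; apply: is_derive_line.
  have dl : is_derive (0 : R) (1 : R)
      (fun h : R => c * ((h *: basis_vector j + x) ord0 i : R) + d) (c * (i == j)%:R).
    have h0 : is_derive (0 : R) (1 : R) (fun h : R => c * (i == j)%:R * h + (c * x ord0 i + d)) (c * (i == j)%:R).
      have := is_deriveD (is_deriveZ (c * (i == j)%:R) (is_derive_id (0 : R) (1 : R)))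
        (is_derive_cst (c * x ord0 i + d) (0 : R) (1 : R)).
      by rewrite addr0 [_ *: 1]mulr1.
    congr (is_derive _ _ _ _): h0; apply/funext => h.
    by rewrite !mxE eqxx/= eq_sym; ring.
  have := is_derive1_comp (is_derive_flat m _) dl.
  by rewrite scale0r add0r /= mulrC mulNr.
- split; first exact: cst_continuous.
  by move=> i; exists (cst 0); [constructor|move=> x; exact: is_derive_cst].
- split; first by move=> x; apply: continuousD; [exact: cf|exact: cg].
  move=> i; have [f' Sf' f'P] := df i; have [g' Sg' g'P] := dg i.
  by exists (f' \+ g'); [constructor|move=> x; exact: is_deriveD].
- split; first by move=> x; apply: continuousM; [exact: cf|exact: cg].
  move=> i; have [f' Sf' f'P] := df i; have [g' Sg' g'P] := dg i.
  exists (f \* g' \+ g \* f'); first by do !(constructor => //).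
  by move=> x; exact: is_deriveM.
Qed.

Lemma bump_smooth f : bump_algebra f -> smooth f.
Proof.
move=> Sf s; have : bump_algebra (iter_partial s f).
  elim: s => [//|i s IH] /=; have [_ /(_ i)[g Sg gP]] := bump_derive IH.
  rewrite (_ : partial i _ = g)//.
  by apply/funext => x; rewrite /partial (derive_val (is_derive := gP x)).
move=> /bump_derive[cf df]; split => // i x.
by have [g _ /(_ x)[]] := df i.
Qed.

(** Each factor is exp(-1/((j+1)s)), with s the signed distance to a face: it vanishes outside and
    tends to 1 inside as j grows. Indicators of open boxes are thus bounded pointwise limits of test
    functions, and the translates of these bumps are bumps of the same kind. *)
Definition box_bump (a b : 'rV[R]_n) (j : nat) (x : 'rV[R]_n) : R :=
  \prod_(i < n) (flat 0 (j.+1%:R * (x ord0 i - a ord0 i)) *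
                 flat 0 (j.+1%:R * (b ord0 i - x ord0 i))).

Lemma flat0_le1 (s : R) : flat 0 s <= 1.
Proof.
rewrite /flat; case: ifPn => // s0.
by rewrite expr0 mul1r -expR0 ler_expR oppr_le0 invr_ge0 ltW.
Qed.

Lemma box_bump_ge0 a b j x : 0 <= box_bump a b j x.
Proof. by apply: prodr_ge0 => i _; rewrite mulr_ge0// flat_ge0. Qed.

Lemma box_bump_le1 a b j x : box_bump a b j x <= 1.
Proof.
suff /andP[] : 0 <= box_bump a b j x <= 1 by [].
rewrite /box_bump; apply: (@big_ind _ (fun t : R => 0 <= t <= 1)).
- by rewrite ler01 lexx.
- by move=> s t /andP[s0 s1] /andP[t0 t1]; rewrite mulr_ge0// mulr_ile1.
- by move=> i _; rewrite mulr_ge0 ?mulr_ile1 ?flat_ge0 ?flat0_le1.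
Qed.

Lemma box_bump_out a b j x : ~ box a b x -> box_bump a b j x = 0.
Proof.
move=> /existsNP[i /negP]; rewrite negb_and -!leNgt => xab.
apply/eqP/prodf_eq0; exists i => //; rewrite mulf_eq0 /flat.
case/orP: xab => xab; apply/orP; [left|right]; rewrite ifF// ltNge; apply/negbTE;
  by rewrite negbK pmulr_rle0// subr_le0.
Qed.

Lemma box_bump_cvg a b x : box_bump a b j x @[j --> \oo] --> (\1_(box a b) x : R).
Proof.
rewrite indicE; have [xab|xab] := boolP (x \in box a b); last first.
  rewrite (_ : (fun _ => _) = cst 0); first exact: cvg_cst.
  by apply/funext => j; rewrite box_bump_out//; move: xab; rewrite notin_setE.
have f1 (t : R) : 0 < t -> flat 0 (j.+1%:R * t) @[j --> \oo] --> (1 : R).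
  move=> t0; rewrite -[X in _ --> X]expR0 /flat.
  rewrite (_ : (fun _ => _) = fun j => expR (- (t^-1 * j.+1%:R^-1))); last first.
    by apply/funext => j; rewrite mulr_gt0// expr0 mul1r invfM mulrC.
  apply: continuous_cvg; first exact: continuous_expR.
  rewrite -oppr0; apply: cvgN; rewrite -[X in _ --> X](mulr0 t^-1).
  by apply: cvgMr; exact: cvg_harmonic.
rewrite (_ : 1%:R = \prod_(i < n) (1 * 1 : R)); last first.
  by rewrite mulr1 big1.
have fc i : flat 0 (j.+1%:R * (x ord0 i - a ord0 i)) *
    flat 0 (j.+1%:R * (b ord0 i - x ord0 i)) @[j --> \oo] --> (1 * 1 : R).
  by apply: cvgM; apply: f1; rewrite subr_gt0; move: xab; rewrite inE => /(_ i)/andP[].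
rewrite /box_bump; elim: (index_enum _) => [|i s IH].
  under eq_fun do rewrite big_nil.
  by rewrite big_nil; exact: cvg_cst.
under eq_fun do rewrite big_cons.
by rewrite big_cons; apply: cvgM; [exact: fc|exact: IH].
Qed.

Lemma test_function_box_bump a b j : test_function (box_bump a b j).
Proof.
split.
  apply: bump_smooth; rewrite /box_bump.
  rewrite (_ : (fun _ => _) = fun x : 'rV[R]_n => \prod_(i < n)
    (flat 0 (j.+1%:R * x ord0 i + (- (j.+1%:R * a ord0 i))) *
     flat 0 (- j.+1%:R * x ord0 i + j.+1%:R * b ord0 i))); last first.
    apply/funext => x; apply: eq_bigr => i _.
    by rewrite !mulrBr mulNr [in X in _ * flat 0 X]addrC.
  elim: (index_enum _) => [|i s IH].
    rewrite (_ : (fun _ => _) = cst 1); first by constructor.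
    by apply/funext => x; rewrite big_nil.
  under eq_fun do rewrite big_cons.
  apply: (bump_mul _ IH); apply: (@bump_mul (fun x => flat 0 (j.+1%:R * x ord0 i + _))
    (fun x => flat 0 (- j.+1%:R * x ord0 i + _))); constructor.
pose K := [set x : 'rV[R]_n | forall i, `[a ord0 i, b ord0 i]%classic (x ord0 i)].
have cK : compact K.
  by apply: (@rV_compact _ _ (fun i => `[a ord0 i, b ord0 i]%classic)) => i;
    exact: segment_compact.
apply: (subclosed_compact _ cK); first exact: closed_closure.
have clK : closed K.
  apply: compact_closed => //; exact: norm_hausdorff.
rewrite /supp; apply: subset_trans (_ : closure K `<=` K).
  apply: closure_subset => x /= /eqP h i.
  have : box a b x by apply: contrapT => /(@box_bump_out _ _ j).
  by move=> /(_ i)/andP[? ?]; rewrite /= in_itv/= !ltW.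
by move/closure_id : clK => <-.
Qed.

End smooth_bumps.

Section test_functions.
Context {R : realType} {n : nat}.
Implicit Types (phi : 'rV[R]_n -> R) (i : 'I_n).

Lemma continuous_measurable_rV phi : continuous phi -> measurable_fun setT phi.
Proof.
move=> cphi; apply: (measurability _ (RGenOpens.measurableE R)).
move=> _ [_ [a [b ->] <-]]; rewrite setTI; apply: open_measurable_rV.
by apply: open_comp; [move=> x _; exact: cphi|exact: interval_open].
Qed.

Lemma smooth_continuous phi : smooth phi -> continuous phi.
Proof. by move=> /(_ [::])[]. Qed.

Lemma smooth_derivable phi i x : smooth phi -> derivable phi x (basis_vector i).
Proof. by move=> /(_ [::])[_]; exact. Qed.

Lemma smooth_partial phi i : smooth phi -> smooth (partial i phi).
Proof.
move=> sphi s; have := sphi (rcons s i).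
by rewrite /iter_partial -cats1 foldr_cat.
Qed.

Lemma out_supp phi x : ~ supp phi x -> phi x = 0.
Proof.
by move=> xK; apply: contrapT => /eqP x0; apply: xK; exact: subset_closure.
Qed.

Lemma near_out_supp phi x : ~ supp phi x -> \forall y \near x, phi y = 0.
Proof.
move=> xK; have : nbhs x (~` supp phi).
  by apply: open_nbhs_nbhs; split => //; apply: closed_openC; exact: closed_closure.
by apply: filterS => y; exact: out_supp.
Qed.

Lemma partial_out_supp phi i x : ~ supp phi x -> partial i phi x = 0.
Proof.
move=> /near_out_supp phi0.
suff d0 : is_derive x (basis_vector i : 'rV[R]_n) phi 0.
  exact: (derive_val (is_derive := d0)).
apply: near_eq_is_derive (is_derive_cst 0 x _).
by apply: filterS phi0 => y ->.
Qed.

Lemma supp_partial phi i : supp (partial i phi) `<=` supp phi.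
Proof.
have -> : supp phi = closure (supp phi) by apply/closure_id; exact: closed_closure.
apply: closure_subset => x /= /eqP h; apply: contrapT => /(@partial_out_supp _ i).
exact: h.
Qed.

Lemma test_function_partial phi i : test_function phi -> test_function (partial i phi).
Proof.
move=> [sphi cphi]; split; first exact: smooth_partial.
by apply: subclosed_compact (@supp_partial phi i) => //; exact: closed_closure.
Qed.

Lemma test_function_bounded phi : test_function phi ->
  exists C, 0 <= C /\ forall x, `|phi x| <= C.
Proof.
move=> [sphi cphi].
have [M [Mr HM]] : bounded_set (phi @` supp phi).
  apply: compact_bounded; apply: continuous_compact => //.
  by apply: continuous_subspaceT; exact: smooth_continuous.
exists (Num.max M 0 + 1); split; first by rewrite addr_ge0// le_max lexx orbT.
move=> x; have [xK|/out_supp->] := pselect (supp phi x); last first.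
  by rewrite normr0 addr_ge0// le_max lexx orbT.
apply: HM; last by exists x.
by rewrite (@le_lt_trans _ _ (Num.max M 0)) ?le_max ?lexx// ltrDl.
Qed.

Lemma measurable_test_function phi : test_function phi -> measurable_fun setT phi.
Proof. by move=> [sphi _]; exact: continuous_measurable_rV (smooth_continuous sphi). Qed.

Lemma is_derive_along phi i x t : smooth phi ->
  is_derive t (1 : R) (fun t => phi (x - t *: basis_vector i))
    (- partial i phi (x - t *: basis_vector i)).
Proof.
move=> sphi; set e := basis_vector i.
have dphi : is_derive (- t) (1 : R) (fun s => phi (x + s *: e))
    (partial i phi (x - t *: e)).
  have := @smooth_derivable phi i (x - t *: e) sphi.
  rewrite /partial /derivable /derive -/e.
  have E : (fun h : R => h^-1 *: ((phi \o shift (x - t *: e)) (h *: e) - phi (x - t *: e))) =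
    (fun h : R => h^-1 *: (((fun s => phi (x + s *: e)) \o shift (- t)) (h *: (1 : R))
       - phi (x + (- t) *: e))).
    apply/funext => h /=; rewrite [h *: 1]mulr1 scalerDl scaleNr.
    by rewrite addrCA.
  by rewrite E => d; split.
have := is_derive1_comp dphi (is_deriveN (is_derive_id t (1 : R))).
rewrite mulrN1; congr (is_derive _ _ _ _).
by apply/funext => s /=; rewrite scaleNr.
Qed.

Lemma smooth_FTC phi i x (s t : R) : smooth phi -> s <= t ->
  (\int[lebesgue_measure]_(r in `[s, t]) (partial i phi (x - r *: basis_vector i))%:E =
   (phi (x - s *: basis_vector i) - phi (x - t *: basis_vector i))%:E)%E.
Proof.
move=> sphi; rewrite le_eqVlt => /predU1P[->|st].
  by rewrite set_itv1 integral_set1 subrr.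
set e := basis_vector i; pose F r := - phi (x - r *: e).
have dF r : is_derive r (1 : R) F (partial i phi (x - r *: e)).
  by rewrite -[partial _ _ _]opprK; exact/is_deriveN/is_derive_along.
have cF : continuous F.
  move=> r; apply: differentiable_continuous; apply/derivable1_diffP.
  by have [] := dF r.
rewrite (@continuous_FTC2 _ _ F s t st).
- by rewrite /F -EFinB opprK addrC.
- apply: continuous_subspaceT => r.
  apply: (@continuous_comp _ _ _ (fun r : R => x - r *: e) (partial i phi)).
    apply: cvgB; first exact: cvg_cst.
    by apply: cvgZr_tmp; exact: cvg_id.
  exact/smooth_continuous/smooth_partial.
- split => [r _| |]; first by have [] := dF r.
  + exact/cvg_at_right_filter/cF.
  + exact/cvg_at_left_filter/cF.
- by move=> r _; rewrite derive1E; have [] := dF r.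
Qed.

End test_functions.

(** * Densities, restrictions and shifts of measures *)

Section density.
Context d (T : measurableType d) (R : realType) (mu : {measure set T -> \bar R}).
Variable f : T -> \bar R.
Local Open Scope ereal_scope.

(** The two proofs are arguments because the measure structure declared below is built from them and
    has to be recovered from the term [density mf f0]. *)
Definition density (mf : measurable_fun setT f) (f0 : forall x, 0 <= f x) :=
  fun A => \int[mu]_(x in A) f x.

Hypotheses (mf : measurable_fun setT f) (f0 : forall x, 0 <= f x).

Let density0 : density mf f0 set0 = 0.
Proof. by rewrite /density integral_set0. Qed.

Let density_ge0 A : 0 <= density mf f0 A.
Proof. by apply: integral_ge0 => x _. Qed.

Let density_sigma_additive : semi_sigma_additive (density mf f0).
Proof. exact: semi_sigma_additive_nng_induced. Qed.

HB.instance Definition _ := isMeasure.Build _ _ _ (density mf f0)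
  density0 density_ge0 density_sigma_additive.

End density.

Section restriction.
Context d (T : measurableType d) (R : realType) (mu : {measure set T -> \bar R}).
Variables (D : set T) (mD : measurable D) (Doo : (mu D < +oo)%E).
Local Open Scope ereal_scope.

Lemma ge0_integral_mfrestr (f : T -> \bar R) : measurable_fun setT f ->
  (forall x, 0 <= f x) ->
  \int[mfrestr mD Doo]_x f x = \int[mu]_(x in D) f x.
Proof.
move=> mf f0.
rewrite (@ge0_negligible_integral _ _ _ _ setT (~` D))//; last 2 first.
- exact: measurableC.
- by rewrite /= /mfrestr /mrestr setICl measure0.
rewrite setTD setCK; apply: eq_measure_integral => A mA AD.
by rewrite /= /mfrestr /mrestr setIidl.
Qed.

Lemma integral_mfrestr (f : T -> \bar R) : measurable_fun setT f ->
  \int[mfrestr mD Doo]_x f x = \int[mu]_(x in D) f x.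
Proof.
move=> mf; rewrite [LHS]integralE [RHS]integralE !ge0_integral_mfrestr//.
- exact: measurable_funeneg.
- exact: measurable_funepos.
Qed.

End restriction.

Lemma partial_shift (R : realType) n (i : 'I_n) (phi : 'rV[R]_n -> R) (c : 'rV[R]_n) :
  partial i (fun y => phi (y - c)) = (fun y => partial i phi (y - c)).
Proof.
apply/funext => y; rewrite /partial /derive.
rewrite (_ : (fun h : R => _) = (fun h : R => h^-1 *:
  ((phi \o shift (y - c)) (h *: basis_vector i) - phi (y - c))))//.
by apply/funext => h /=; rewrite addrA.
Qed.

Lemma integrable_mul_bounded d (T : measurableType d) (R : realType)
    (mu : {measure set T -> \bar R}) (f g : T -> R) (C : R) :
  mu.-integrable setT (EFin \o f) -> measurable_fun setT g ->
  (forall x, `|g x| <= C) -> mu.-integrable setT (fun x => (f x * g x)%:E).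
Proof.
move=> /[dup] /integrableP[/measurable_EFinP mf _] fi mg gC.
apply: (@le_integrable _ _ _ _ _ _ _ (fun x => (C%:E * (f x)%:E)%E)) => //.
- by apply/measurable_EFinP; exact: measurable_funM.
- move=> x _; rewrite -EFinM /= lee_fin normrM mulrC normrM.
  rewrite ler_wpM2r//; apply: le_trans (ler_norm _); exact: gC.
- exact: integrableZl.
Qed.

Lemma measurable_measure_shift (R : realType) n (e : 'rV[R]_n)
    (m : {finite_measure set 'rV[R]_n -> \bar R}) (E : set 'rV[R]_n) : measurable E ->
  measurable_fun [set: measurableTypeR R]
    (fun r : measurableTypeR R => m [set y | E (y - r *: e)]).
Proof.
move=> mE; pose sh (z : 'rV[R]_n * measurableTypeR R) : 'rV[R]_n := z.1 - z.2 *: e.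
have msh : measurable_fun setT sh.
  apply: measurable_addrV; first exact: measurable_fst.
  under eq_fun do rewrite -scaleNr.
  by apply: measurable_scalerV; apply: measurableT_comp => //; exact: measurable_snd.
have mb : measurable (sh @^-1` E) by rewrite -[X in measurable X]setTI; exact: msh.
have := measurable_fun_ysection m mb.
apply: eq_measurable_fun => r _ /=; congr (m _).
by apply/seteqP; split => y; rewrite /ysection/= inE.
Qed.

(** * Translations of functions of bounded variation *)

Section translation_estimate.
Context {R : realType} {n : nat} (i : 'I_n).
Variables (u : 'rV[R]_n -> R) (p q : {finite_measure set 'rV[R]_n -> \bar R}).
Local Open Scope ereal_scope.
Local Notation e := (basis_vector i : 'rV[R]_n).
Hypothesis iu : leb.-integrable setT (EFin \o u).
Hypothesis du : forall phi : 'rV[R]_n -> R, test_function phi ->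
  - (\int[leb]_x (u x * partial i phi x)%:E) =
  \int[p]_x (phi x)%:E - \int[q]_x (phi x)%:E.
Variables (s t : R).
Hypothesis st : (s <= t)%R.

Let mu_ : measurable_fun setT u.
Proof. by move/integrableP : iu => [/measurable_EFinP]. Qed.

Let itv_lty : lebesgue_measure (`[s, t]%classic : set (measurableTypeR R)) < +oo.
Proof. by rewrite lebesgue_measure_itv/=; case: ifP => _; rewrite ?ltry. Qed.

Let mitv : measurable (`[s, t]%classic : set (measurableTypeR R)).
Proof. exact: measurable_itv. Qed.

Let T : {finite_measure set (measurableTypeR R) -> \bar R} :=
  mfrestr mitv itv_lty.

Let w (y : 'rV[R]_n) : R := u (y + t *: e)%R - u (y + s *: e)%R.

Let shift (z : 'rV[R]_n * measurableTypeR R) : 'rV[R]_n := (z.1 - z.2 *: e)%R.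

Let mshift : measurable_fun setT shift.
Proof.
apply: measurable_addrV; first exact: measurable_fst.
under eq_fun do rewrite -scaleNr.
by apply: measurable_scalerV; apply: measurableT_comp => //; exact: measurable_snd.
Qed.

Let shift_box r a b : (fun y => shift (y, r)) @^-1` box a b =
  box (a + r *: e)%R (b + r *: e)%R.
Proof.
apply/seteqP; split => x h k; have := h k; rewrite /shift !mxE/=.
  by rewrite ltrBrDr ltrBlDr.
by rewrite ltrBrDr ltrBlDr.
Qed.

Let box_bump_shift a b j y r :
  box_bump (a + r *: e)%R (b + r *: e)%R j y = box_bump a b j (y - r *: e)%R.
Proof.
apply: eq_bigr => k _; rewrite !mxE; congr (flat _ (_ * _) * flat _ (_ * _))%R; ring.
Qed.

Let iw : leb.-integrable setT (EFin \o w).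
Proof.
rewrite (_ : EFin \o w = (fun y => (u (y + t *: e))%:E) \- (fun y => (u (y + s *: e))%:E))//.
by apply: integrableB => //; exact: integrable_translation iu.
Qed.

(** Translation moves the increment of u onto phi, where it is minus the integral of [partial i phi]
    along the segment; after Fubini the weak formulation is applied to the translate of phi by r e,
    for each r. That the translates are test functions is assumed here and checked for box bumps. *)
Let test_identity phi : test_function phi ->
  (forall r, test_function (fun y => phi (y - r *: e)%R)) ->
  (forall r, partial i (fun y => phi (y - r *: e)%R) =
     (fun y => partial i phi (y - r *: e)%R)) ->
  \int[leb]_y (w y * phi y)%:E =
  \int[T]_r (\int[p]_y (phi (y - r *: e)%R)%:E - \int[q]_y (phi (y - r *: e)%R)%:E).
Proof.
move=> tphi tphir dphir.
have [C [C0 phiC]] := test_function_bounded tphi.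
have [C' [C'0 dphiC]] := test_function_bounded (test_function_partial i tphi).
have mphi := continuous_measurable_rV (smooth_continuous tphi.1).
have mdphi := continuous_measurable_rV (smooth_continuous (test_function_partial i tphi).1).
have iuphi r : leb.-integrable setT (fun y => (u y * phi (y - r *: e)%R)%:E).
  apply: (integrable_mul_bounded (C := C)) => //.
  exact: (measurableT_comp mphi (measurable_translation _)).
have intu r : \int[leb]_y (u (y + r *: e) * phi y)%:E =
    \int[leb]_y (u y * phi (y - r *: e)%R)%:E.
  rewrite -[RHS](integral_translation (r *: e)).
    by apply: eq_integral => y _; rewrite addrK.
  exact: measurable_int (iuphi r).
pose F (z : 'rV[R]_n * measurableTypeR R) := (- (u z.1 * partial i phi (shift z)))%:E.
have mF : measurable_fun setT F.
  apply/measurable_EFinP; apply: measurable_funN; apply: measurable_funM.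
    by apply: measurableT_comp => //; exact: measurable_fst.
  exact: (measurableT_comp mdphi mshift).
have [K K0 TK] : exists2 K : R, (0 <= K)%R & T setT = K%:E.
  exists (fine (T setT)); first exact: fine_ge0.
  by rewrite fineK// fin_num_measure.
(* [partial i phi] is bounded by [C'] and [T] has total mass [K], so [C' * K] times |u| dominates
   the inner integral. *)
have iF : (leb \x T).-integrable setT F.
  apply/integrable12ltyP => //.
  apply: (@le_lt_trans _ _ (\int[leb]_y ((C' * K)%:E * `|(u y)%:E|))).
    apply: ge0_le_integral => //.
    - by move=> y _; apply: integral_ge0.
    - by apply: (measurable_fun_fubini_tonelli_F (fun z => `|F z|)) => //;
        exact: measurableT_comp.
    - by apply: measurable_funeM; apply: measurableT_comp => //; exact/measurable_EFinP.
    move=> y _; rewrite [X in _ <= X](_ : _ = \int[T]_r ((C' * `|u y|)%:E)); last first.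
      by rewrite integral_cst// [X in _ = _ * X]TK abse_EFin -!EFinM mulrAC.
    apply: ge0_le_integral => //.
    - by apply: measurableT_comp => //; exact: measurableT_comp mF (pair1_measurable y).
    - by move=> r _; rewrite /F/= lee_fin normrN normrM mulrC ler_wpM2r.
  have /integrableP[_ uoo] := iu.
  rewrite ge0_integralZl//; last 2 first.
    by apply: measurableT_comp => //; exact/measurable_EFinP.
    by rewrite lee_fin mulr_ge0.
  by apply: lte_mul_pinfty => //; rewrite lee_fin mulr_ge0.
transitivity (\int[leb]_y \int[T]_r F (y, r)).
  transitivity (\int[leb]_y ((u y * phi (y - t *: e)%R)%:E - (u y * phi (y - s *: e)%R)%:E)).
    rewrite integralB// -!intu -integralB//.
    - by apply: eq_integral => y _; rewrite -EFinB -mulrBl.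
    - by apply: integrable_mul_bounded phiC => //; exact: (integrable_translation _ iu).
    - by apply: integrable_mul_bounded phiC => //; exact: (integrable_translation _ iu).
  apply: eq_integral => y _.
  rewrite integral_mfrestr; last exact: measurableT_comp mF (pair1_measurable y).
  rewrite /F /shift /=.
  under eq_integral do rewrite -mulNr EFinM.
  rewrite integralZl//=; last first.
    apply: (@measurable_bounded_integrable _ _ _ lebesgue_measure
      (fun r => partial i phi (y - r *: e)) `[s, t]%classic) => //.
    - apply: measurable_funTS.
      exact: measurableT_comp mdphi (measurableT_comp mshift (pair1_measurable y)).
    - exists C'; split; first exact: num_real.
      by move=> x /ltW Cx r _; exact: le_trans (dphiC _) Cx.
  rewrite smooth_FTC//; last exact: tphi.1.
  by rewrite -EFinM -EFinB; congr EFin; ring.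
rewrite (Fubini iF); apply: eq_integral => r _.
rewrite -(du (tphir r)) dphir -integralN.
  by apply: eq_integral => y _; rewrite -EFinN.
apply: integrable_add_def => //; apply: (integrable_mul_bounded (C := C')) => //.
exact: measurableT_comp mdphi (measurable_translation _).
Qed.

(** The superposition of the translates of [m] by -r e for r in [s, t]. As the image of a product
    measure it is at once known to be a measure. *)
Let rho (m : {finite_measure set 'rV[R]_n -> \bar R}) : {measure set 'rV[R]_n -> \bar R} :=
  measure_function_pushforward__canonical__measure_function_Measure
    (m \x^ T) mshift.

Let rhoE m E : rho m E = \int[T]_r m ((fun y => shift (y, r)) @^-1` E).
Proof.
rewrite /rho /= /pushforward /product_measure2; apply: eq_integral => r _ /=.
by congr (m _); apply/seteqP; split => y; rewrite /ysection/= inE.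
Qed.

Let mbump a b j : measurable_fun setT (fun z => (box_bump a b j (shift z))%:E).
Proof.
apply/measurable_EFinP; apply: (measurableT_comp _ mshift).
exact: measurable_test_function (test_function_box_bump a b j).
Qed.

Let bump_le (m : {finite_measure set 'rV[R]_n -> \bar R}) a b j r :
  `|\int[m]_y (box_bump a b j (y - r *: e)%R)%:E| <= m setT.
Proof.
rewrite gee0_abs; last by apply: integral_ge0 => y _; rewrite lee_fin box_bump_ge0.
rewrite -[leRHS]mul1e -integral_cst//; apply: ge0_le_integral => //.
- by move=> y _; rewrite lee_fin box_bump_ge0.
- exact: measurableT_comp (mbump a b j) (pair2_measurable r).
- by move=> y _; rewrite lee_fin box_bump_le1.
Qed.

Let rho_integrable (m : {finite_measure set 'rV[R]_n -> \bar R}) a b j :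
  T.-integrable setT (fun r => \int[m]_y (box_bump a b j (y - r *: e)%R)%:E).
Proof.
apply: (@le_integrable _ _ _ _ _ _ _ (cst (fine (m setT))%:E)) => //.
- apply: (measurable_fun_fubini_tonelli_G (fun z => (box_bump a b j (shift z))%:E)).
    exact: mbump.
  by move=> z; rewrite lee_fin box_bump_ge0.
- move=> r _ /=; apply: (le_trans (bump_le m a b j r)).
  by rewrite ger0_norm ?fine_ge0// fineK ?fin_num_measure.
- exact: finite_measure_integrable_cst.
Qed.

(** Dominated convergence twice: in y for fixed r, with dominant 1, then in r, with dominant
    [m setT]. *)
Let rho_box_cvg (m : {finite_measure set 'rV[R]_n -> \bar R}) a b :
  \int[T]_r \int[m]_y (box_bump a b j (y - r *: e)%R)%:E @[j --> \oo] -->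
  rho m (box a b).
Proof.
rewrite rhoE.
pose G j z : \bar R := (box_bump a b j (shift z))%:E.
have mG j : measurable_fun setT (G j).
  apply/measurable_EFinP; apply: (measurableT_comp _ mshift).
  exact: measurable_test_function (test_function_box_bump a b j).
have G0 j z : 0 <= G j z by rewrite lee_fin box_bump_ge0.
have G1 j z : `|G j z| <= 1 by rewrite gee0_abs// lee_fin box_bump_le1.
have mbox : measurable (shift @^-1` box a b).
  by rewrite -[X in measurable X]setTI; apply: mshift => //; exact: measurable_box.
have inner r : \int[m]_y G j (y, r) @[j --> \oo] --> m ((fun y => shift (y, r)) @^-1` box a b).
  have mb : measurable ((fun y => shift (y, r)) @^-1` box a b).
    by rewrite shift_box; exact: measurable_box.
  have -> : m ((fun y => shift (y, r)) @^-1` box a b) =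
     \int[m]_y (\1_((fun y => shift (y, r)) @^-1` box a b) y)%:E.
    by rewrite integral_indic// setIT.
  have := @dominated_convergence _ _ _ m setT measurableT
    (fun j y => G j (y, r)) (fun y => (\1_((fun y => shift (y, r)) @^-1` box a b) y)%:E)
    (cst 1).
  case => //.
  - by move=> j; exact: measurableT_comp (mG j) (pair2_measurable r).
  - by apply/measurable_EFinP; exact: measurable_indic.
  - apply: aeW => y _; apply: cvg_EFin; first exact: nearW.
    exact: box_bump_cvg.
  - exact: finite_measure_integrable_cst.
  - by apply: aeW => y j _; exact: G1.
have := @dominated_convergence _ _ _ T setT measurableT
    (fun j r => \int[m]_y G j (y, r)) (fun r => m ((fun y => shift (y, r)) @^-1` box a b))
    (cst (m setT)).
case => //.
- by move=> j; apply: (measurable_fun_fubini_tonelli_G (G j)).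
- have := measurable_fun_ysection m mbox.
  apply: eq_measurable_fun => r _ /=; congr (m _).
  by apply/seteqP; split => y; rewrite /ysection/= inE.
- by apply: aeW => r _; exact: inner.
- rewrite (_ : cst (m setT) = cst (fine (m setT))%:E).
    exact: finite_measure_integrable_cst.
  by apply/funext => r /=; rewrite fineK// fin_num_measure.
- by apply: aeW => r j _; exact: bump_le.
Qed.

Let rho_lty m E : measurable E -> rho m E < +oo.
Proof.
move=> mE; apply: (@le_lt_trans _ _ (rho m setT)).
  by apply: le_measure => //; rewrite inE.
rewrite rhoE [X in X < _](_ : _ = \int[T]_r (cst (m setT) r)) ?integral_cst//.
by rewrite lte_mul_pinfty// ?fin_num_measure// ltey_eq fin_num_measure.
Qed.

Let box_identity a b :
  \int[leb]_(y in box a b) (w y)%:E = rho p (box a b) - rho q (box a b).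
Proof.
have := @dominated_convergence _ _ _ leb setT measurableT
    (fun j y => (w y * box_bump a b j y)%:E) (fun y => (w y * \1_(box a b) y)%:E)
    (fun y => `|(w y)%:E|).
have mw : measurable_fun setT w by move/integrableP : iw => [/measurable_EFinP].
case => //.
- move=> j; apply/measurable_EFinP; apply: measurable_funM => //.
  exact: measurable_test_function (test_function_box_bump a b j).
- apply/measurable_EFinP; apply: measurable_funM => //.
  by apply: measurable_indic; exact: measurable_box.
- apply: aeW => y _; apply: cvg_EFin; first exact: nearW.
  by apply: cvgMr; exact: box_bump_cvg.
- exact: integrable_abse.
- apply: aeW => y j _; rewrite lee_fin normrM ler_piMr// ger0_norm ?box_bump_ge0//.
  exact: box_bump_le1.
move=> _ _ wcvg.
rewrite integral_mkcond.
rewrite (_ : (fun y => (w y)%:E) \_ (box a b) = fun y => (w y * \1_(box a b) y)%:E); last first.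
  apply/funext => y; rewrite patchE indicE; case: ifP => _; first by rewrite mulr1.
  by rewrite mulr0.
apply: cvg_unique wcvg _ => //.
rewrite (_ : (fun j => _) = fun j =>
  \int[T]_r \int[p]_y (box_bump a b j (y - r *: e)%R)%:E -
  \int[T]_r \int[q]_y (box_bump a b j (y - r *: e)%R)%:E); last first.
  apply/funext => j.
  rewrite test_identity.
  - by rewrite integralB//; exact: rho_integrable.
  - exact: test_function_box_bump.
  - move=> r; rewrite (_ : (fun y => _) = box_bump (a + r *: e)%R (b + r *: e)%R j).
      exact: test_function_box_bump.
    by apply/funext => y; rewrite box_bump_shift.
  - by move=> r; rewrite partial_shift.
apply: cvgeB; [|exact: rho_box_cvg|exact: rho_box_cvg].
rewrite fin_num_adde_defl// fin_numN ge0_fin_numE ?rho_lty//.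
exact: measurable_box.
Qed.

Let wp0 y : 0 <= (Num.max (w y) 0)%:E. Proof. by rewrite lee_fin le_max lexx orbT. Qed.
Let wn0 y : 0 <= (Num.max (- w y) 0)%:E. Proof. by rewrite lee_fin le_max lexx orbT. Qed.

Let mw : measurable_fun setT w.
Proof. by move/integrableP : iw => [/measurable_EFinP]. Qed.

Let mwp : measurable_fun setT (fun y => (Num.max (w y) 0)%:E).
Proof. by apply/measurable_EFinP; exact: measurable_maxr. Qed.

Let mwn : measurable_fun setT (fun y => (Num.max (- w y) 0)%:E).
Proof. by apply/measurable_EFinP; apply: measurable_maxr => //; exact: measurable_funN. Qed.

Let iwp : leb.-integrable setT (fun y => (Num.max (w y) 0)%:E).
Proof.
apply: le_integrable iw => // y _; rewrite lee_fin ger0_norm ?le_max ?lexx ?orbT//.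
by rewrite ge_max ler_norm normr_ge0.
Qed.

Let iwn : leb.-integrable setT (fun y => (Num.max (- w y) 0)%:E).
Proof.
apply: le_integrable iw => // y _; rewrite lee_fin ger0_norm ?le_max ?lexx ?orbT//.
by rewrite ge_max normr_ge0 andbT -normrN ler_norm.
Qed.

(** This is [box_identity] with w split into its positive and negative parts and the negative terms
    moved across: both sides are now positive measures, so equality on boxes extends to Borel
    sets. *)
Let identity E : measurable E ->
  density leb mwp wp0 E + rho q E = density leb mwn wn0 E + rho p E.
Proof.
pose m1 : {measure set 'rV[R]_n -> \bar R} := measure_add (density leb mwp wp0) (rho q).
pose m2 : {measure set 'rV[R]_n -> \bar R} := measure_add (density leb mwn wn0) (rho p).
have m1E A : m1 A = density leb mwp wp0 A + rho q A by exact: measure_addE.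
have m2E A : m2 A = density leb mwn wn0 A + rho p A by exact: measure_addE.
rewrite -m1E -m2E.
have fp a b : density leb mwp wp0 (box a b) \is a fin_num.
  apply: (integrable_fin_num (measurable_box a b)).
  by apply: integrableS iwp => //; exact: measurable_box.
have fn a b : density leb mwn wn0 (box a b) \is a fin_num.
  apply: (integrable_fin_num (measurable_box a b)).
  by apply: integrableS iwn => //; exact: measurable_box.
have frho m a b : rho m (box a b) \is a fin_num.
  by rewrite ge0_fin_numE// rho_lty//; exact: measurable_box.
apply: rV_measure_unique => a b; rewrite m1E ?m2E; last first.
  by rewrite lte_add_pinfty// ltey_eq ?fp ?frho.
have := box_identity a b.
rewrite (_ : \int[leb]_(y in box a b) (w y)%:E =
   density leb mwp wp0 (box a b) - density leb mwn wn0 (box a b)); last first.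
  rewrite /density -(integralB (measurable_box a b)); last 2 first.
  - by apply: integrableS iwp => //; exact: measurable_box.
  - by apply: integrableS iwn => //; exact: measurable_box.
  apply: eq_integral => y _; rewrite -EFinB; congr EFin.
  by rewrite /Num.max; case: ltP => ?; case: ltP => ?; lra.
move: (fp a b) (fn a b) (frho p a b) (frho q a b).
move: (density _ _ _ _) (density _ _ _ _) (rho p _) (rho q _).
move=> [x1| |]// [x2| |]// [x3| |]// [x4| |]// _ _ _ _.
by rewrite -!EFinB -!EFinD => -[h]; congr EFin; lra.
Qed.

(** Where w >= 0, the measure with density w- vanishes and [identity] leaves w+ <= [rho p]; where w
    < 0, it leaves w- <= [rho q]. Splitting [E] by the sign of w gives the sum of the two. *)
Lemma translation_estimate E : measurable E ->
  \int[leb]_(y in E) `|u (y + t *: e)%R - u (y + s *: e)%R|%:E <=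
  \int[lebesgue_measure]_(r in `[s, t])
    (p [set y | E (y - r *: e)%R] + q [set y | E (y - r *: e)%R]).
Proof.
move=> mE.
have mE' m := measurable_measure_shift e m mE.
rewrite -(integral_mfrestr mitv itv_lty); last exact: emeasurable_funD.
rewrite ge0_integralD//.
have -> : \int[T]_r p [set y | E (y - r *: e)%R] = rho p E by rewrite rhoE.
have -> : \int[T]_r q [set y | E (y - r *: e)%R] = rho q E by rewrite rhoE.
pose P := [set y | (0 <= w y)%R].
have mP : measurable P.
  rewrite (_ : P = w @^-1` `[0%R, +oo[%classic); last first.
    by apply/seteqP; split => y; rewrite /P /= in_itv/= andbT.
  by rewrite -[X in measurable X]setTI; apply: mw => //; exact: measurable_itv.
have mEP : measurable (E `&` P) by exact: measurableI.
have mEN : measurable (E `&` ~` P) by apply: measurableI => //; exact: measurableC.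
have EP : E = (E `&` P) `|` (E `&` ~` P) by rewrite -setIUr setUv setIT.
rewrite {1}EP ge0_integral_setU//=; last 2 first.
- by apply/measurable_EFinP; apply: measurable_funTS; exact: measurableT_comp.
- by apply/disj_setPS => y [[_ ?] []].
have dp : density leb mwp wp0 (E `&` P) <= rho p (E `&` P).
  apply: le_trans (leeDl _ _) _; first exact: (measure_ge0 (rho q) (E `&` P)).
  rewrite identity// /density integral0_eq ?add0e// => y [_ /= Py].
  by rewrite max_r// oppr_le0.
have dq : density leb mwn wn0 (E `&` ~` P) <= rho q (E `&` ~` P).
  apply: le_trans (leeDl _ _) _; first exact: (measure_ge0 (rho p) (E `&` ~` P)).
  rewrite -identity// /density integral0_eq ?add0e// => y [_ /= /negP].
  by rewrite -ltNge => Py; rewrite max_r// ltW.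
apply: leeD.
  apply: (@le_trans _ _ (rho p (E `&` P))); last first.
    by apply: le_measure; rewrite ?inE//; exact: subIsetl.
  apply: le_trans dp; rewrite le_eqVlt; apply/orP; left; apply/eqP.
  apply: eq_integral => y /[!inE] -[_ Py].
  by rewrite ger0_norm// max_l.
apply: (@le_trans _ _ (rho q (E `&` ~` P))); last first.
  by apply: le_measure; rewrite ?inE//; exact: subIsetl.
apply: le_trans dq; rewrite le_eqVlt; apply/orP; left; apply/eqP.
apply: eq_integral => y /[!inE] -[_ /= /negP]; rewrite -ltNge => Py.
by rewrite ltr0_norm// max_l// oppr_ge0 ltW.
Qed.

End translation_estimate.

Definition cube_volume (R : realType) (n : nat) (r : R) : R := (r *+ 2) ^+ n.

(** * The weak type estimate *)

Section maximal_measure.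
Context {R : realType} {n : nat}.
Implicit Types (k : maximal_kind) (x : 'rV[R]_n).
Local Open Scope ereal_scope.

Lemma cube_volume_gt0 (r : R) : (0 < r)%R -> (0 < cube_volume n r)%R.
Proof. by move=> r0; rewrite exprn_gt0// pmulrn_rgt0. Qed.

Lemma lebesgue_ball (c : 'rV[R]_n) (r : R) : (0 < r)%R ->
  lebesgue_rV R n (ball c r) = (cube_volume n r)%:E.
Proof. exact: leb_ball. Qed.

Lemma maximal_gtP k (mu : set 'rV[R]_n -> \bar R) x (l : R) :
  l%:E < maximal_measure k mu x <-> exists c r,
    admissible_cube k x c r /\ (l * cube_volume n r)%:E < mu (ball c r).
Proof.
split.
  move=> /ereal_sup_gt[_ [[c r] /= [r0 H] <-]] h; exists c, r; split => //.
  move: h; rewrite lebesgue_ball// inver gt_eqF ?cube_volume_gt0// .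
  by rewrite lte_pdivlMr ?cube_volume_gt0// -EFinM.
move=> [c [r [[r0 H] h]]]; apply: (@lt_le_trans _ _ (mu (ball c r) / lebesgue_rV R n (ball c r))).
  rewrite lebesgue_ball// inver gt_eqF ?cube_volume_gt0//.
  by rewrite lte_pdivlMr ?cube_volume_gt0// -EFinM.
by apply: ereal_sup_ubound; exists (c, r).
Qed.

Lemma maximal_ge k (mu : set 'rV[R]_n -> \bar R) x c r :
  admissible_cube k x c r -> mu (ball c r) <= (cube_volume n r)%:E * maximal_measure k mu x.
Proof.
move=> [r0 H]; rewrite -lee_pdivrMl ?cube_volume_gt0// muleC.
have -> : (cube_volume n r)^-1%:E = (lebesgue_rV R n (ball c r))^-1.
  by rewrite lebesgue_ball// inver gt_eqF// cube_volume_gt0.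
by apply: ereal_sup_ubound; exists (c, r).
Qed.

Lemma maximal_ge0 k (mu : set 'rV[R]_n -> \bar R) x : (forall A, 0 <= mu A) ->
  0 <= maximal_measure k mu x.
Proof.
move=> mu0; apply: (@le_trans _ _ (mu (ball x 1) / lebesgue_rV R n (ball x 1))).
  by rewrite mule_ge0// lebesgue_ball// inver gt_eqF ?cube_volume_gt0// lee_fin
    invr_ge0 ltW// cube_volume_gt0.
by apply: ereal_sup_ubound; exists (x, 1%R) => //; split => //; case: k => //=; exact: ballxx.
Qed.

Lemma le_maximal k (mu nu : set 'rV[R]_n -> \bar R) x :
  (forall c r, (0 < r)%R -> mu (ball c r) <= nu (ball c r)) ->
  maximal_measure k mu x <= maximal_measure k nu x.
Proof.
move=> munu; apply: ge_ereal_sup => _ [[c r] /= H <-].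
apply: (@le_trans _ _ (nu (ball c r) / lebesgue_rV R n (ball c r))); last first.
  by apply: ereal_sup_ubound; exists (c, r).
case: H => r0 _; rewrite lebesgue_ball// inver gt_eqF ?cube_volume_gt0//.
by apply: lee_wpmul2r; [rewrite lee_fin invr_ge0 ltW// cube_volume_gt0|exact: munu].
Qed.

Lemma maximal_centred_le (mu : set 'rV[R]_n -> \bar R) k x :
  maximal_measure k mu x <= maximal_measure NonCentred mu x.
Proof.
apply: ge_ereal_sup => _ [[c r] /= [r0 H] <-].
apply: ereal_sup_ubound; exists (c, r) => //; split => //=.
by case: k H => //= ->; exact: ballxx.
Qed.

Lemma nbhs_open (O : set 'rV[R]_n) : (forall x, O x -> nbhs x O) -> open O.
Proof. by rewrite openE. Qed.

(** A non-centred cube serves every point that it contains. For a centred one, some slightly smaller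
    concentric cube still carries more mass than l times the full volume, by continuity from below,
    and it lies in the full-size cube centred at any nearby point. *)
Lemma open_maximal_gt k (mu : {measure set 'rV[R]_n -> \bar R}) (l : R) :
  open [set x | l%:E < maximal_measure k mu x].
Proof.
apply: nbhs_open => x /= /maximal_gtP[c [r [[r0]]]]; case: k => /= [-> {c}|xc] h; last first.
  have : nbhs x (ball c r) by apply: open_nbhs_nbhs; split => //; exact: ball_open.
  by apply: filterS => y yc; apply/maximal_gtP; exists c, r.
pose F j : set 'rV[R]_n := ball x (r - r / j.+2%:R)%R.
have ndF : nondecreasing_seq F.
  move=> i j ij; apply/subsetPset; apply: le_ball.
  by rewrite lerD2l lerN2 ler_pM2l// lef_pV2 ?posrE// ler_nat.
have UF : \bigcup_j F j = ball x r.
  apply/seteqP; split => [y [j _]|y].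
    by apply: le_ball; rewrite gerBl// divr_ge0// ltW.
  rewrite mx_norm_ball /ball_ /= => xyr.
  have d0 : (0 < (r - `|x - y|) / r)%R by rewrite divr_gt0// subr_gt0.
  have [j je] : exists j : nat, (j.+1%:R^-1 < (r - `|x - y|) / r)%R.
    near \oo => j; exists j; near: j; exact: near_infty_natSinv_lt (PosNum d0).
  exists j => //; rewrite /F mx_norm_ball /ball_ /=.
  rewrite ltrBrDr -ltrBrDl mulrC -ltr_pdivlMr//.
  by rewrite (lt_trans _ je)// ltf_pV2 ?posrE// ltr_nat.
have [j Fj] : exists j, (l * cube_volume n r)%:E < mu (F j).
  apply: contrapT => /forallNP H.
  have : mu (ball x r) <= (l * cube_volume n r)%:E.
    have cF : mu (F j) @[j --> \oo] --> mu (ball x r).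
      rewrite -UF; apply: nondecreasing_cvg_mu => //.
      - by move=> j; exact: measurable_ball_rV.
      - by apply: bigcupT_measurable => j; exact: measurable_ball_rV.
    rewrite -(cvg_lim _ cF)//; apply: lime_le; first by apply/cvg_ex; eexists; exact: cF.
    by apply: nearW => j; rewrite leNgt; apply/negP; exact: H.
  by rewrite leNgt h.
have d0 : (0 < r / j.+2%:R)%R by rewrite divr_gt0.
have : nbhs x (ball x (r / j.+2%:R)%R) by exact: nbhsx_ballx.
apply: filterS => y xy; apply/maximal_gtP; exists y, r; split => //.
apply: (lt_le_trans Fj); apply: le_measure; rewrite ?inE; try exact: measurable_ball_rV.
move=> z xz; have := ball_triangle (ball_sym xy) xz.
by rewrite addrC subrK.
Unshelve. all: by end_near. Qed.

Lemma measurable_maximal_gt k (mu : {measure set 'rV[R]_n -> \bar R}) (l : R) :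
  measurable [set x | l%:E < maximal_measure k mu x].
Proof. by apply: open_measurable_rV; exact: open_maximal_gt. Qed.

Lemma measurable_maximal k (mu : {measure set 'rV[R]_n -> \bar R}) :
  measurable_fun setT (maximal_measure k mu).
Proof.
apply: (measurability _ (ErealGenOInfty.measurableE R)).
move=> _ [_ [l ->] <-]; rewrite setTI; rewrite (_ : _ @^-1` _ = [set x | l%:E < maximal_measure k mu x]).
  exact: measurable_maximal_gt.
by apply/seteqP; split => x; rewrite /= in_itv/= andbT.
Qed.

Let U (s : seq ('rV[R]_n * R)) := [set x : 'rV[R]_n | exists2 b, b \in s & ball b.1 b.2 x].

Let mU s : measurable (U s).
Proof.
rewrite (_ : U s = \bigcup_(b in [set` s]) ball b.1 b.2).
  by apply: fin_bigcup_measurable => // b _; exact: measurable_ball_rV.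
by apply/seteqP; split => x [b]; exists b.
Qed.

(* Vitali covering argument, phrased so that the disjoint subfamily never has to
   be named: discard the cubes meeting a largest one and induct. *)
Lemma finite_vitali (mu : {measure set 'rV[R]_n -> \bar R}) (l : R)
    (s : seq ('rV[R]_n * R)) : (0 < l)%R ->
  (forall b, b \in s -> (0 < b.2)%R /\ (l * cube_volume n b.2)%:E <= mu (ball b.1 b.2)) ->
  l%:E * leb (U s) <= (3 ^+ n)%:E * mu (U s).
Proof.
move=> l0; have [m] := ubnP (size s); elim: m s => // m IH s sm Hs.
have [->|s0] := eqVneq s [::].
  rewrite (_ : U [::] = set0) ?measure0 ?mule0//.
  by apply/seteqP; split => x // [].
have [b bs bmax] : exists2 b, b \in s & forall b', b' \in s -> (b'.2 <= b.2)%R.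
  elim: s s0 {sm Hs} => // a [_ _|a' s IHs _].
    by exists a; rewrite ?mem_head// => b'; rewrite inE => /eqP->.
  have [//|b bs bmax] := IHs.
  have [ab|ab] := leP a.2 b.2.
    exists b; first by rewrite inE bs orbT.
    by move=> b'; rewrite inE => /predU1P[->//|/bmax].
  exists a; first exact: mem_head.
  by move=> b'; rewrite inE => /predU1P[->//|/bmax /le_trans]; apply; exact: ltW.
pose s' := [seq b' <- s | `[< ball b'.1 b'.2 `&` ball b.1 b.2 = set0 >]].
have [b0 bl] := Hs _ bs.
have ss' : (size s' < size s)%N.
  rewrite size_filter -(count_predC (fun b' => `[< ball b'.1 b'.2 `&` ball b.1 b.2 = set0 >]) s).
  rewrite -[ltnLHS]addn0 ltn_add2l -has_count; apply/hasP; exists b => //=.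
  apply/asboolP; rewrite setIid => b_0.
  by have : set0 b.1 by rewrite -b_0; exact: ballxx.
have {}IH := IH s' (leq_trans ss' sm).
have /IH {}IH : forall b', b' \in s' ->
    (0 < b'.2)%R /\ (l * cube_volume n b'.2)%:E <= mu (ball b'.1 b'.2).
  by move=> b'; rewrite mem_filter => /andP[_ /Hs].
(* A discarded cube meets the largest one and is no larger, so it lies in the concentric cube of
   triple radius: the origin of [3 ^+ n]. *)
have cover : U s `<=` ball b.1 (3 * b.2)%R `|` U s'.
  move=> x [b' b's b'x].
  have [d|/eqP/set0P[y [y1 y2]]] := pselect (ball b'.1 b'.2 `&` ball b.1 b.2 = set0).
    by right; exists b' => //; rewrite mem_filter b's andbT; exact/asboolP.
  left; have := ball_triangle (ball_triangle y2 (ball_sym y1)) b'x.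
  apply: le_ball; have := bmax _ b's; lra.
have disj : ball b.1 b.2 `&` U s' = set0.
  apply/seteqP; split => x // [bx [b' +]]; rewrite mem_filter => /andP[/asboolP d _] b'x.
  by rewrite -d.
apply: (@le_trans _ _ (l%:E * (leb (ball b.1 (3 * b.2)%R) + leb (U s')))).
  apply: lee_wpmul2l; first by rewrite lee_fin ltW.
  apply: le_trans (measureU2 _ _ _); rewrite ?inE//; [|exact: measurable_ball_rV..].
  by apply: le_measure => //; rewrite inE//; apply: measurableU => //; exact: measurable_ball_rV.
rewrite ge0_muleDr//.
apply: (@le_trans _ _ ((3 ^+ n)%:E * (mu (ball b.1 b.2) + mu (U s')))).
  rewrite ge0_muleDr//; apply: leeD => //.
  rewrite leb_ball ?mulr_gt0// -EFinM.
  rewrite (_ : (l * _)%R = (3 ^+ n * (l * cube_volume n b.2))%R); last first.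
    by rewrite /cube_volume -mulrnAr exprMn mulrCA.
  by rewrite EFinM lee_wpmul2l// lee_fin exprn_ge0.
apply: lee_wpmul2l; first by rewrite lee_fin exprn_ge0.
rewrite -measureU//; last exact: measurable_ball_rV.
apply: le_measure; rewrite ?inE//; first by apply: measurableU => //; exact: measurable_ball_rV.
move=> x [bx|[b' + b'x]]; first by exists b.
by rewrite mem_filter => /andP[_ b's]; exists b'.
Qed.

(** Centred cubes are among the non-centred ones, so the latter case suffices. There the superlevel
    set is covered by an increasing sequence of finite unions of cubes of large average, each of
    them bounded by [finite_vitali]. *)
Lemma maximal_weak_type k (mu : {measure set 'rV[R]_n -> \bar R}) (l : R) : (0 < l)%R ->
  l%:E * leb [set x | l%:E < maximal_measure k mu x] <= (3 ^+ n)%:E * mu setT.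
Proof.
move=> l0.
apply: (@le_trans _ _ (l%:E * leb [set x | l%:E < maximal_measure NonCentred mu x])).
  apply: lee_wpmul2l; first by rewrite lee_fin ltW.
  apply: le_measure; rewrite ?inE.
  - exact: measurable_maximal_gt.
  - exact: measurable_maximal_gt.
  - by move=> x /= /lt_le_trans; apply; exact: maximal_centred_le.
pose Q (p : 'rV[rat]_n * nat) := ball (map_mx ratr p.1 : 'rV[R]_n) (p.2.+1%:R^-1 : R).
pose good p (b : 'rV[R]_n * R) := [/\ (0 < b.2)%R, (l * cube_volume n b.2)%:E < mu (ball b.1 b.2)
  & Q p `<=` ball b.1 b.2].
(* [B j] holds at most one cube: a good one containing the rational cube of code [j] if there is
   any, and none otherwise. Using lists avoids a default cube, which might fail to be good. *)
have /choice[B BP] : forall j : nat, exists s : seq ('rV[R]_n * R),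
    (forall b, b \in s -> (0 < b.2)%R /\ (l * cube_volume n b.2)%:E < mu (ball b.1 b.2)) /\
    (forall p b, unpickle j = Some p -> good p b -> Q p `<=` U s).
  move=> j; case E : (@unpickle ('rV[rat]_n * nat)%type j) => [p|]; last first.
    by exists [::]; split.
  have [[b [b0 bl Qb]]|nb] := pselect (exists b, good p b).
    exists [:: b]; split; first by move=> b'; rewrite inE => /eqP ->.
    by move=> _ _ [<-] _ x /Qb bx; exists b => //; rewrite mem_head.
  exists [::]; split => // _ b [<-] gb; exfalso; apply: nb; by exists b.
pose V N := flatten [seq B j | j <- iota 0 N].
have VP N b : b \in V N -> (0 < b.2)%R /\ (l * cube_volume n b.2)%:E <= mu (ball b.1 b.2).
  by move=> /flatten_mapP[j _ /(BP j).1[? /ltW]].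
have ndV : nondecreasing_seq (fun N => U (V N)).
  move=> M N MN; apply/subsetPset => x [b /flatten_mapP[j jM bj] bx].
  exists b => //; apply/flatten_mapP; exists j => //.
  by move: jM; rewrite !mem_iota !add0n => /leq_trans; apply.
have cover : [set x | l%:E < maximal_measure NonCentred mu x] `<=` \bigcup_N U (V N).
  move=> x /= /maximal_gtP[c [r [[r0 /= cx] h]]].
  have [p [Qx Qc]] := rat_ball (ball_open c r) cx.
  have [b bB bx] := (BP (pickle p)).2 p (c, r) (pickleK p) (And3 r0 h Qc) x Qx.
  exists (pickle p).+1 => //; exists b => //; apply/flatten_mapP.
  by exists (pickle p) => //; rewrite mem_iota add0n ltnS leqnn.
have mUV : measurable (\bigcup_N U (V N)) by exact: bigcupT_measurable.
apply: (@le_trans _ _ (l%:E * leb (\bigcup_N U (V N)))).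
  apply: lee_wpmul2l; first by rewrite lee_fin ltW.
  by apply: le_measure => //; rewrite inE//; exact: measurable_maximal_gt.
have cV : leb (U (V N)) @[N --> \oo] --> leb (\bigcup_N U (V N)).
  by apply: nondecreasing_cvg_mu.
rewrite -lee_pdivlMl// -(cvg_lim _ cV)//; apply: lime_le.
  by apply/cvg_ex; eexists; exact: cV.
apply: nearW => N; rewrite lee_pdivlMl//; apply: le_trans (finite_vitali l0 (@VP N)) _.
apply: lee_wpmul2l; first by rewrite lee_fin exprn_ge0.
by apply: le_measure; rewrite ?inE.
Qed.

(** The set of infinite values lies in every superlevel set, so l times its measure is bounded
    independently of l. *)
Lemma maximal_ae_lty k (mu : {measure set 'rV[R]_n -> \bar R}) : mu setT < +oo ->
  {ae leb, forall x, maximal_measure k mu x < +oo}.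
Proof.
move=> muoo; exists [set x | maximal_measure k mu x = +oo]; split.
- have := emeasurable_fun_c_infty measurableT (measurable_maximal k mu) +oo.
  rewrite setTI; congr (measurable _); apply/seteqP; split => x /=.
    by rewrite leye_eq => /eqP.
  by move=> ->.
- apply/eqP; rewrite eq_le measure_ge0 andbT.
  have H (l : R) : (0 < l)%R ->
      l%:E * leb [set x | maximal_measure k mu x = +oo] <= (3 ^+ n)%:E * mu setT.
    move=> l0; apply: le_trans (maximal_weak_type k mu l0).
    apply: lee_wpmul2l; first by rewrite lee_fin ltW.
    apply: le_measure; rewrite ?inE.
    + have := emeasurable_fun_c_infty measurableT (measurable_maximal k mu) +oo.
      rewrite setTI; congr (measurable _); apply/seteqP; split => x /=.
        by rewrite leye_eq => /eqP.
      by move=> ->.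
    + exact: measurable_maximal_gt.
    + by move=> x /= ->; rewrite ltry.
  have : mu setT \is a fin_num by rewrite ge0_fin_numE.
  move: H (measure_ge0 leb [set x | maximal_measure k mu x = +oo]).
  case: (leb _) => [a| |] H //; last first.
    move=> _; have := H 1%R ltr01.
    by rewrite mul1e leye_eq => /eqP; case: (mu setT).
  case: (mu setT) H => // b H; rewrite !lee_fin => a0 _.
  rewrite leNgt; apply/negP => a_gt0.
  have b0 : (0 <= 3 ^+ n * b)%R.
    by have := H 1%R ltr01; rewrite -!EFinM lee_fin mul1r; exact: le_trans (ltW a_gt0).
  (* For this level the left side of [H] exceeds the right side by 1. *)
  have l0 : (0 < (3 ^+ n * b + 1) / a)%R by rewrite divr_gt0// ltr_wpDl.
  by have := H _ l0; rewrite -!EFinM lee_fin divfK ?gt_eqF// gerDl ler10.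
- by move=> x /= /negP; rewrite -leNgt leye_eq => /eqP.
Qed.

End maximal_measure.

(** * Tonelli on rectangles and averages over translates *)

Section tonelli_in.
Context d1 d2 (T1 : measurableType d1) (T2 : measurableType d2) (R : realType).
Variables (m1 : {sigma_finite_measure set T1 -> \bar R})
          (m2 : {sigma_finite_measure set T2 -> \bar R}).
Variables (A : set T1) (B : set T2) (F : T1 * T2 -> \bar R).
Local Open Scope ereal_scope.
Hypotheses (mA : measurable A) (mB : measurable B).
Hypotheses (mF : measurable_fun setT F) (F0 : forall z, 0 <= F z).

Let mFAB : measurable_fun setT (F \_ (A `*` B)).
Proof.
apply/(measurable_restrictT _ (measurableX mA mB)).
exact: measurable_funTS.
Qed.

Let FAB0 z : 0 <= (F \_ (A `*` B)) z.
Proof. by rewrite patchE; case: ifP. Qed.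

Lemma tonelli1_in : \int[m1 \x m2]_(z in A `*` B) F z =
  \int[m1]_(x in A) \int[m2]_(y in B) F (x, y).
Proof.
rewrite integral_mkcond (fubini_tonelli1 _ mFAB FAB0) [RHS]integral_mkcond.
apply: eq_integral => x _; rewrite /fubini_F patchE; case: ifPn => xA.
  rewrite [RHS]integral_mkcond; apply: eq_integral => y _; rewrite !patchE.
  by rewrite in_setX xA.
by apply: integral0_eq => y _; rewrite patchE in_setX (negbTE xA).
Qed.

Lemma tonelli2_in : \int[m1 \x m2]_(z in A `*` B) F z =
  \int[m2]_(y in B) \int[m1]_(x in A) F (x, y).
Proof.
rewrite integral_mkcond (fubini_tonelli2 _ mFAB FAB0) [RHS]integral_mkcond.
apply: eq_integral => y _; rewrite /fubini_G patchE; case: ifPn => yB.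
  rewrite [RHS]integral_mkcond; apply: eq_integral => x _; rewrite !patchE.
  by rewrite in_setX yB andbT.
by apply: integral0_eq => x _; rewrite patchE in_setX (negbTE yB) andbF.
Qed.

Lemma tonelli_in : \int[m1]_(x in A) \int[m2]_(y in B) F (x, y) =
  \int[m2]_(y in B) \int[m1]_(x in A) F (x, y).
Proof. by rewrite -tonelli1_in tonelli2_in. Qed.

Lemma measurable_tonelli1_in :
  measurable_fun setT (fun x => \int[m2]_(y in B) F (x, y)).
Proof.
have mFB : measurable_fun setT (F \_ (setT `*` B)).
  by apply/(measurable_restrictT _ (measurableX measurableT mB)); exact: measurable_funTS.
have := measurable_fun_fubini_tonelli_F (m2 := m2) _ mFB.
have FB0 z : 0 <= (F \_ (setT `*` B)) z by rewrite patchE; case: ifP.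
move=> /(_ FB0); apply: eq_measurable_fun => x _.
rewrite /fubini_F [RHS]integral_mkcond; apply: eq_integral => y _.
by rewrite !patchE in_setX in_setT.
Qed.

End tonelli_in.

Section translated_averages.
Context {R : realType} {n : nat}.
Local Open Scope ereal_scope.

Lemma ball_translation (c v x : 'rV[R]_n) (r : R) :
  ball (c + v)%R r (x + v)%R = ball c r x.
Proof. by rewrite !mx_norm_ball /ball_ /= opprD addrACA subrr addr0. Qed.

Lemma integral_ball_translation (g : 'rV[R]_n -> \bar R) (v c : 'rV[R]_n) (r : R) :
  measurable_fun setT g -> (forall x, 0 <= g x) ->
  \int[leb]_(x in ball c r) g (x + v)%R = \int[leb]_(x in ball (c + v)%R r) g x.
Proof.
move=> mg g0; rewrite [RHS]integral_mkcond.
rewrite -(ge0_integral_translation v); last 2 first.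
- by apply/(measurable_restrictT _ (measurable_ball_rV _ _)); exact: measurable_funTS.
- by move=> x; rewrite patchE; case: ifP.
rewrite integral_mkcond; apply: eq_integral => x _; rewrite !patchE.
have -> : ((x + v)%R \in (ball (c + v)%R r : set 'rV[R]_n)) = (x \in (ball c r : set 'rV[R]_n)).
  by apply/idP/idP; rewrite !inE ball_translation.
by [].
Qed.

(** For each [o] the integral of g(x + W o) over the cube of radius r is at most that of g over
    radius r + s, so by Tonelli the inner integral is integrable in x. It is applied with [W]
    running along a segment and along the edges of a path parallel to the axes. *)
Lemma ae_average_lty d (Om : measurableType d) (P : {sigma_finite_measure set Om -> \bar R})
    (D : set Om) (W : Om -> 'rV[R]_n) (g : 'rV[R]_n -> \bar R) (x0 : 'rV[R]_n) (r s : R) :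
  measurable D -> P D < +oo -> measurable_fun setT W ->
  (forall o, D o -> (`|W o| <= s)%R) ->
  measurable_fun setT g -> (forall x, 0 <= g x) ->
  \int[leb]_(x in ball x0 (r + s)%R) g x < +oo ->
  {ae leb, forall x, ball x0 r x -> \int[P]_(o in D) g (x + W o)%R < +oo}.
Proof.
move=> mD PD mW Ws mg g0 goo.
pose F (z : 'rV[R]_n * Om) := g (z.1 + W z.2)%R.
have mF : measurable_fun setT F.
  apply: (measurableT_comp mg); apply: measurable_addrV; first exact: measurable_fst.
  by apply: measurableT_comp mW _; exact: measurable_snd.
have mG := measurable_tonelli1_in P mD mF (fun z => g0 _).
have mb := measurable_ball_rV x0 r.
have : leb.-integrable (ball x0 r) (fun x => \int[P]_(o in D) F (x, o)).
  apply/integrableP; split; first exact: measurable_funTS.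
  rewrite (_ : \int[leb]_(x in _) _ = \int[leb]_(x in ball x0 r) \int[P]_(o in D) F (x, o)); last first.
    by apply: eq_integral => x _; rewrite gee0_abs//; apply: integral_ge0 => o _; exact: g0.
  rewrite (tonelli_in _ _ mb mD mF)//; last by move=> z; exact: g0.
  apply: (@le_lt_trans _ _ (\int[P]_(o in D) (cst (\int[leb]_(x in ball x0 (r + s)%R) g x) o))).
    apply: ge0_le_integral => //.
    - by move=> o _; apply: integral_ge0 => x _; exact: g0.
    - apply: measurable_funTS.
      have mF' : measurable_fun setT (fun z : Om * 'rV[R]_n => F (z.2, z.1)).
        by apply: (measurableT_comp mF); exact: measurable_swap.
      exact: (measurable_tonelli1_in leb mb mF' (fun z => g0 _)).
    move=> o Do; rewrite /F /= (integral_ball_translation (W o) x0 r mg g0).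
    apply: ge0_subset_integral => //; try exact: measurable_ball_rV.
      exact: measurable_funTS.
    move=> x; rewrite !mx_norm_ball /ball_ /= => h.
    rewrite (_ : x0 - x = (x0 + W o - x) - W o)%R; last by rewrite addrAC addrK.
    apply: le_lt_trans (ler_normB _ _) _; exact: ltr_leD h (Ws _ Do).
  rewrite integral_cst// lte_mul_pinfty// ?integral_ge0//.
  by rewrite ge0_fin_numE// integral_ge0.
move/(integrable_ae mb); apply: filterS => x h /h.
by rewrite fin_numElt => /andP[].
Qed.

End translated_averages.

(** * The maximal function along lines *)

Section maximal_along_lines.
Context {R : realType} {n : nat} (k : maximal_kind).
Variables (u : 'rV[R]_n -> R) (m : {finite_measure set 'rV[R]_n -> \bar R}) (e : 'rV[R]_n).
Local Open Scope ereal_scope.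
Hypothesis iu : leb.-integrable setT (EFin \o u).
Hypothesis du : forall s t E, (s <= t)%R -> measurable E ->
  \int[leb]_(y in E) `|u (y + t *: e)%R - u (y + s *: e)%R|%:E <=
  \int[lebesgue_measure]_(r in `[s, t]) m [set y | E (y - r *: e)%R].

Let mu_ : measurable_fun setT u.
Proof. by move/integrableP : iu => [/measurable_EFinP]. Qed.

Let ball_shift (c : 'rV[R]_n) r v : [set y | ball c r (y - v)%R] = ball (c + v)%R r.
Proof.
by apply/seteqP; split => y /=; rewrite -(ball_translation c v) subrK.
Qed.

Lemma measurable_line (x : 'rV[R]_n) :
  measurable_fun [set: measurableTypeR R] (fun r : measurableTypeR R => x + r *: e)%R.
Proof. by apply: measurable_addrV => //; exact: measurable_scalerV. Qed.

(** A cube admissible at x + a e, moved by (b - a) e, is admissible at x + b e, and the two means of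
    |u| differ by at most the mean of the increment of u. By [H] that is controlled by the masses
    [m] gives to the moving cube, which is admissible at x + r e for every r. Keeping [a], [b] apart
    from [s], [t] covers both orders of the endpoints. *)
Let maximal_line_aux x a b s t :
  (forall E, measurable E -> \int[leb]_(y in E) `|u (y + a *: e)%R - u (y + b *: e)%R|%:E <=
     \int[lebesgue_measure]_(r in `[s, t]) m [set y | E (y - r *: e)%R]) ->
  maximal_fun k u (x + a *: e)%R <= maximal_fun k u (x + b *: e)%R +
    \int[lebesgue_measure]_(r in `[s, t]) maximal_measure k m (x + r *: e)%R.
Proof.
move=> H; apply: ge_ereal_sup => _ [[c r] /= [r0 cx] <-].
set c0 := (c - a *: e)%R.
have adm w : admissible_cube k (x + w *: e)%R (c0 + w *: e)%R r.
  split => //; rewrite /c0; case: k cx => /= [->|]; first by rewrite addrK.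
  rewrite -(ball_translation c (w *: e - a *: e)%R); congr (ball _ _ _).
    by rewrite [(w *: e - _)%R]addrC addrA.
  by rewrite -addrA [X in (_ + X)%R]addrCA subrr addr0.
have v0 : (0 < cube_volume n r)%R by exact: cube_volume_gt0.
have mabs w : measurable_fun setT (fun y : 'rV[R]_n => `|u (y + w *: e)%R|%:E).
  apply/measurable_EFinP; apply: measurableT_comp => //.
  by apply: measurableT_comp => //; exact: measurable_translation.
have N w : \int[leb]_(y in ball c0 r) `|u (y + w *: e)%R|%:E =
    \int[leb]_(y in ball (c0 + w *: e)%R r) `|u y|%:E.
  rewrite (integral_ball_translation (g := fun y => `|u y|%:E))//.
  by apply/measurable_EFinP; exact: measurableT_comp.
have mb := measurable_ball_rV c0 r.
have key : \int[leb]_(y in ball c r) `|u y|%:E <= (cube_volume n r)%:E *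
  (maximal_fun k u (x + b *: e)%R +
    \int[lebesgue_measure]_(r in `[s, t]) maximal_measure k m (x + r *: e)%R).
  rewrite -{1}[c](subrK (a *: e)%R) -/c0 -N.
  apply: (@le_trans _ _ (\int[leb]_(y in ball c0 r) `|u (y + b *: e)%R|%:E +
     \int[leb]_(y in ball c0 r) `|u (y + a *: e)%R - u (y + b *: e)%R|%:E)).
    have mdiff : measurable_fun setT (fun y : 'rV[R]_n => `|u (y + a *: e)%R - u (y + b *: e)%R|%:E).
      apply/measurable_EFinP; apply: measurableT_comp => //.
      by apply: measurable_funB; apply: measurableT_comp => //; exact: measurable_translation.
    rewrite -ge0_integralD//; try exact: measurable_funTS.
    apply: ge0_le_integral => //; try exact: measurable_funTS.
      by apply: measurable_funTS; exact: emeasurable_funD.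
    move=> y _; rewrite -EFinD lee_fin -[X in (`|X| <= _)%R](subrK (u (y + b *: e))%R) addrC.
    exact: ler_normD.
  rewrite ge0_muleDr; last 2 first.
  - by apply: maximal_ge0 => A; exact: integral_ge0.
  - by apply: integral_ge0 => y _; exact: maximal_ge0.
  apply: leeD.
    by rewrite N; exact: (maximal_ge (fun Q => \int[leb]_(y in Q) `|u y|%:E) (adm b)).
  apply: le_trans (H _ mb) _.
  have mg : measurable_fun `[s, t] (fun r : measurableTypeR R => maximal_measure k m (x + r *: e)%R).
    apply: measurable_funTS; apply: measurableT_comp; first exact: measurable_maximal.
    exact: measurable_line.
  rewrite -ge0_integralZl//; last 2 first.
  - by move=> y _; exact: maximal_ge0.
  - by rewrite lee_fin ltW.
  apply: ge0_le_integral => //.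
  - by apply: measurable_funTS; exact: measurable_measure_shift.
  - by apply: emeasurable_funM.
  - move=> w _; rewrite ball_shift; exact: maximal_ge.
rewrite lebesgue_ball// inver gt_eqF// muleC.
by rewrite lee_pdivrMl.
Qed.

Lemma maximal_line x s t : (s <= t)%R ->
  maximal_fun k u (x + t *: e)%R <= maximal_fun k u (x + s *: e)%R +
    \int[lebesgue_measure]_(r in `[s, t]) maximal_measure k m (x + r *: e)%R.
Proof. by move=> st; apply: maximal_line_aux => E mE; exact: du. Qed.

Lemma maximal_line_rev x s t : (s <= t)%R ->
  maximal_fun k u (x + s *: e)%R <= maximal_fun k u (x + t *: e)%R +
    \int[lebesgue_measure]_(r in `[s, t]) maximal_measure k m (x + r *: e)%R.
Proof.
move=> st; apply: maximal_line_aux => E mE; apply: le_trans (du st mE).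
by under eq_integral do rewrite distrC.
Qed.

Lemma fine_maximal_line x s t : (s <= t)%R ->
  `|fine (maximal_fun k u (x + t *: e)%R) - fine (maximal_fun k u (x + s *: e)%R)|%:E <=
  \int[lebesgue_measure]_(r in `[s, t]) maximal_measure k m (x + r *: e)%R.
Proof.
move=> st; move: (maximal_line x st) (maximal_line_rev x st).
have : 0 <= \int[lebesgue_measure]_(r in `[s, t]) maximal_measure k m (x + r *: e)%R.
  by apply: integral_ge0 => y _; exact: maximal_ge0.
move: (\int[lebesgue_measure]_(r in `[s, t]) _) => [I| |] //; last by move=> *; rewrite leey.
move=> I0.
have f0 y : 0 <= maximal_fun k u y by apply: maximal_ge0 => A; exact: integral_ge0.
move: (f0 (x + t *: e)%R) (f0 (x + s *: e)%R).
(* The integral being finite, M u is finite at both ends or infinite at both; in the latter case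
   [fine] sends both values to 0. *)
move: (maximal_fun k u _) (maximal_fun k u _) => [a| |] // [b| |] // _ _ /=.
  by rewrite -!EFinD !lee_fin ler_norml => h1 h2; apply/andP; split; lra.
by move=> _ _; rewrite subrr normr0.
Qed.

End maximal_along_lines.

(** * Absolutely continuous functions of one variable *)

Section absolutely_continuous.
Context {R : realType}.
Local Notation mu := (@lebesgue_measure R).
Variables (F g : R -> R).
Hypothesis g0 : forall x, 0 <= g x.
Hypothesis ig : mu.-integrable setT (EFin \o g).
Hypothesis Fg : forall s t, s <= t ->
  (`|F t - F s|%:E <= \int[mu]_(x in `[s, t]) (g x)%:E)%E.

Let G t := (\int[mu]_(x in `]-oo, t]) g x)%R.

Let igI (i : interval R) : mu.-integrable [set` i] (EFin \o g).
Proof. by apply: integrableS ig => //; exact: measurable_itv. Qed.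

Let GB s t : s <= t -> ((G t - G s)%:E = \int[mu]_(x in `]s, t]) (g x)%:E)%E.
Proof.
move=> st; rewrite /G Rintegral_itvB//.
by rewrite /Rintegral fineK//; apply: integrable_fin_num => //; exact: measurable_itv.
Qed.

Let FG s t : s <= t -> `|F t - F s| <= G t - G s.
Proof.
move=> st; rewrite -lee_fin GB//; apply: le_trans (Fg st) _.
rewrite (integral_itv_obnd_cbnd (r := s) (b := BRight t) (f := EFin \o g))//.
by have /integrableP[] := igI `]s, t].
Qed.

Let G_nd s t : s <= t -> G s <= G t.
Proof. by move=> st; rewrite -subr_ge0; apply: le_trans (FG st). Qed.

Let G_rc e t : 0 < e -> \forall h \near 0^'+, G (t + h) - G t < e.
Proof.
move=> e0; have [d [d0 dP]] := integral_normr_continuous ig e0.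
near=> h; have h0 : 0 < h by near: h; exact: nbhs_right_gt.
have hd : h < d by near: h; exact: nbhs_right_lt.
rewrite -lte_fin GB ?lerDl ?ltW//.
have mI : measurable (`]t, t + h]%classic : set (measurableTypeR R)) by exact: measurable_itv.
have hlt : (mu `]t, (t + h)%R]%classic < d%:E)%E.
  by rewrite lebesgue_measure_itv/= lte_fin ltrDl h0 -EFinD addrAC subrr add0r lte_fin.
have := dP _ mI hlt; rewrite -lte_fin /Rintegral fineK.
  by under eq_integral do rewrite ger0_norm//.
under eq_integral do rewrite ger0_norm//.
by apply: integrable_fin_num => //; exact: measurable_itv.
Unshelve. all: by end_near. Qed.

(* [W] ranges over [G + F], [G - F] and [2 G]. *)
Let right_continuous_dominated (W : R -> R) :
  (forall s t, s <= t -> `|W t - W s| <= 2 * (G t - G s)) -> right_continuous W.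
Proof.
move=> WG t; apply/cvgrPdist_lt => e e0.
have e20 : 0 < e / 2 by rewrite divr_gt0.
have [d /= d0 dP] := @G_rc (e / 2) t e20.
exists d => //= x xd tx.
rewrite distrC (le_lt_trans (WG _ _ (ltW tx)))//.
rewrite -ltr_pdivlMl// mulrC.
have := dP (x - t); rewrite /= sub0r normrN distrC subr_gt0 addrCA subrr addr0; exact.
Qed.

Let LS_itv (W : cumulative R R) s t : s <= t ->
  lebesgue_stieltjes_measure W `]s, t]%classic = (W t - W s)%:E.
Proof.
move=> st; rewrite /lebesgue_stieltjes_measure/= /measure_extension/= measurable_mu_extE/=.
  exact: wlength_itv_bnd.
exact: is_ocitv.
Qed.

Let g2 : measurableTypeR R -> \bar R := fun x => (2 * g x)%:E.
Let mg2 : measurable_fun setT g2.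
Proof.
apply/measurable_EFinP; apply: measurable_funM => //.
by have /integrableP[/measurable_EFinP] := ig.
Qed.
Let g20 x : (0 <= g2 x)%E. Proof. by rewrite lee_fin mulr_ge0. Qed.
Let ig2 : mu.-integrable setT g2.
Proof. by have := integrableZl measurableT 2 ig. Qed.

(** The Stieltjes measures of W and V add up to 2 g dx. The one of W is therefore at most 2 g dx,
    hence finite and absolutely continuous, and [w] is its Radon-Nikodym derivative. *)
Let primitive (W V : R -> R) :
  (forall s t, s <= t -> W s <= W t) -> (forall s t, s <= t -> V s <= V t) ->
  (forall s t, s <= t -> (W t - W s) + (V t - V s) = 2 * (G t - G s)) ->
  exists w : R -> R, mu.-integrable setT (EFin \o w) /\
    forall s t, s <= t -> ((W t - W s)%:E = \int[mu]_(x in `]s, t]) (w x)%:E)%E.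
Proof.
move=> ndW ndV WV.
have bW s t : s <= t -> `|W t - W s| <= 2 * (G t - G s).
  by move=> st; rewrite ger0_norm ?subr_ge0 ?ndW// -WV// lerDl subr_ge0 ndV.
have bV s t : s <= t -> `|V t - V s| <= 2 * (G t - G s).
  by move=> st; rewrite ger0_norm ?subr_ge0 ?ndV// -WV// lerDr subr_ge0 ndW.
have bG s t : s <= t -> `|2 * G t - 2 * G s| <= 2 * (G t - G s).
  by move=> st; rewrite -mulrBr ger0_norm// mulr_ge0// subr_ge0 G_nd.
pose cW : cumulative R R := HB.pack W
  (isCumulative.Build R _ R W ndW (right_continuous_dominated bW)).
pose cV : cumulative R R := HB.pack V
  (isCumulative.Build R _ R V ndV (right_continuous_dominated bV)).
have nd2G s t : s <= t -> 2 * G s <= 2 * G t by move=> st; rewrite ler_wpM2l// G_nd.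
pose cG : cumulative R R := HB.pack (fun t => 2 * G t)
  (isCumulative.Build R _ R (fun t => 2 * G t) nd2G (right_continuous_dominated bG)).
pose nu := lebesgue_stieltjes_measure cW.
pose m1 : {measure set (measurableTypeR R) -> \bar R} :=
  measure_add (lebesgue_stieltjes_measure cW) (lebesgue_stieltjes_measure cV).
pose m2 : {measure set (measurableTypeR R) -> \bar R} := density mu mg2 g20.
have m1E A : m1 A = (nu A + lebesgue_stieltjes_measure cV A)%E by exact: measure_addE.
(* The Stieltjes measure of 2 G is the middle term: on half-open intervals it agrees with [m1] and
   with [m2], and uniqueness is applied to each. *)
have E1 A : measurable A -> lebesgue_stieltjes_measure cG A = m1 A.
  apply: lebesgue_stieltjes_measure_unique => X /ocitvP[->|[[s t] /= st ->]].
    by rewrite !measure0.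
  by rewrite m1E /nu !LS_itv ?ltW//= -EFinD WV ?ltW// mulrBr.
have E2 A : measurable A -> lebesgue_stieltjes_measure cG A = m2 A.
  apply: lebesgue_stieltjes_measure_unique => X /ocitvP[->|[[s t] /= st ->]].
    by rewrite !measure0.
  rewrite LS_itv ?ltW//= -mulrBr EFinM GB ?ltW// -integralZl//.
have nu_le A : measurable A -> (nu A <= \int[mu]_(x in A) g2 x)%E.
  move=> mA; have -> : (\int[mu]_(x in A) g2 x)%E = m1 A by rewrite -E1// E2.
  by rewrite m1E leeDl.
have nuoo : (nu setT < +oo)%E.
  apply: le_lt_trans (nu_le _ measurableT) _.
  by rewrite ltey_eq (integrable_fin_num measurableT ig2).
pose nuf : {finite_measure set (measurableTypeR R) -> \bar R} := mfrestr measurableT nuoo.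
have nufE A : nuf A = nu A by rewrite /nuf /= /mfrestr /mrestr setIT.
have dom : nuf `<< mu.
  apply/null_content_dominatesP => A mA A0; rewrite nufE.
  apply/eqP; rewrite eq_le measure_ge0 andbT (le_trans (nu_le _ mA))//.
  rewrite null_set_integral//.
  by apply: measurable_funTS.
have [w [w0 wfin iw wE]] := radon_nikodym_sigma_finite dom.
exists (fine \o w); split.
  apply: eq_integrable iw => // x _; by rewrite /= fineK.
move=> s t st; have := wE `]s, t]%classic (measurable_itv _).
rewrite nufE /nu LS_itv// => ->; apply: eq_integral => x _; by rewrite /= fineK.
Qed.

(** F need not be monotone, but G + F and G - F are. Almost everywhere F and G are differentiable
    with derivatives [w] and [g], and |F t - F s| <= G t - G s passes to the limit as |w| <= g. *)
Lemma absolutely_continuous_derivative : exists w : R -> R,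
  [/\ mu.-integrable setT (EFin \o w),
      forall s t, s <= t -> ((F t - F s)%:E = \int[mu]_(x in `[s, t]) (w x)%:E)%E &
      {ae mu, forall x, `|w x| <= g x /\
        k.+1%:R * (F (x + k.+1%:R^-1) - F x) @[k --> \oo] --> w x}].
Proof.
have [|||w0 [iw0 w0E]] := @primitive (G \+ F) (G \- F).
- by move=> s t st /=; have := FG st; rewrite ler_norml => /andP[? ?]; lra.
- by move=> s t st /=; have := FG st; rewrite ler_norml => /andP[? ?]; lra.
- by move=> s t st /=; ring.
(* [w0] is the density of G + F and [g] that of G. *)
pose w x := w0 x - g x.
have iw : mu.-integrable setT (EFin \o w).
  rewrite (_ : EFin \o w = (EFin \o w0) \- (EFin \o g))%E//.
  exact: integrableB.
have wE s t : s <= t -> ((F t - F s)%:E = \int[mu]_(x in `]s, t]) (w x)%:E)%E.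
  move=> st; rewrite (_ : F t - F s = ((G \+ F) t - (G \+ F) s) - (G t - G s)); last first.
    by rewrite /=; ring.
  have iw0' : mu.-integrable `]s, t] (EFin \o w0).
    by apply: integrableS iw0 => //; exact: measurable_itv.
  have mI : measurable (`]s, t]%classic : set (measurableTypeR R)) by exact: measurable_itv.
  by rewrite EFinB w0E// GB// -(integralB mI iw0' (igI _)).
have ws (i : interval R) : mu.-integrable [set` i] (EFin \o w).
  by apply: integrableS iw => //; exact: measurable_itv.
exists w; split => //.
  move=> s t st; rewrite wE// (integral_itv_obnd_cbnd (r := s) (b := BRight t) (f := EFin \o w))//.
  by have /integrableP[] := ws `]s, t].
have lw : locally_integrable setT w by apply: open_integrable_locally => //; exact: openT.
have lg : locally_integrable setT g by apply: open_integrable_locally => //; exact: openT.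
have dq (f : R -> R) x l : derivable f x 1 /\ f^`()%classic x = l ->
    k.+1%:R * (f (x + k.+1%:R^-1) - f x) @[k --> \oo] --> l.
  move=> [df dl].
  have : h^-1 *: ((f \o shift x) (h *: 1) - f x) @[h --> 0^'] --> l.
    by rewrite -dl derive1E /derive; exact: df.
  move=> /(cvgr_dnbhsP _ _ _).1 /(_ (fun k => k.+1%:R^-1)) h.
  have k0 (k : nat) : (k.+1%:R^-1 : R) != 0 by rewrite gt_eqF.
  have {}h := h (conj k0 cvg_harmonic).
  apply: cvg_trans h; apply: near_eq_cvg; apply: nearW => k /=.
  have -> : k.+1%:R^-1 *: (1 : R) = k.+1%:R^-1 by exact: mulr1.
  by rewrite invrK (addrC x).
(* The differentiation theorem speaks of this primitive of [w], which has the same increments as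
   F. *)
pose H t := (\int[mu]_(x in `]-oo, t]) w x)%R.
have HF s t : s <= t -> H t - H s = F t - F s.
  move=> st; apply: EFin_inj; rewrite wE// /H Rintegral_itvB//.
  by rewrite /Rintegral fineK//; apply: integrable_fin_num => //; exact: measurable_itv.
have := FTC1Ny (fun y => ws _) lw; have := FTC1Ny (fun y => igI _) lg.
apply: (@filterS2 _ _ (ae_filter_ringOfSetsType mu)) => x /dq dG /dq dH.
have cF : k.+1%:R * (F (x + k.+1%:R^-1) - F x) @[k --> \oo] --> w x.
  apply: cvg_trans dH; apply: near_eq_cvg; near=> k.
  by rewrite -HF ?lerDl.
split => //.
apply: ler_cvg_to (cvg_norm cF) dG _.
apply: nearW => k /=; rewrite normrM ger0_norm// ler_wpM2l//.
by apply: FG; rewrite lerDl.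
Unshelve. all: by end_near. Qed.

End absolutely_continuous.

(** Clamping to [0, r] extends a function on [0, r] by constants. The clamped values of s and t
    either agree or stay inside [s, t], so a bound on increments by an integral over [s, t] survives
    the extension. *)
Lemma clamp_le (R : realType) (r s t : R) : 0 < r -> s <= t ->
  let c x := Num.max 0 (Num.min r x) in
  [/\ c s <= c t /\ (c s = c t \/ s <= c s /\ c t <= t), 0 <= c s & c t <= r].
Proof.
move=> r0 st c.
have c_lo x : x <= 0 -> c x = 0 by move=> x0; rewrite /c min_r ?max_l//; lra.
have c_hi x : r <= x -> c x = r by move=> x0; rewrite /c min_l ?max_r//; lra.
have c_mid x : 0 <= x -> x <= r -> c x = x by move=> x0 x1; rewrite /c min_r ?max_r.
have c0 x : 0 <= c x by rewrite /c le_max lexx.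
have cr x : c x <= r by rewrite /c ge_max ltW//= ge_min lexx.
split => //; have [s0|s0] := lerP s 0.
  rewrite (c_lo s)//; split => //; have [t0|t0] := lerP t 0.
    by left; rewrite c_lo.
  by right; split => //; rewrite /c ge_max ge_min lexx orbT ltW.
have [sr|sr] := lerP s r; last first.
  by rewrite !c_hi//; [split => //; left|lra|lra].
rewrite (c_mid s) ?(ltW s0)//.
have ct : c t <= t by rewrite /c ge_max ge_min lexx orbT andbT; lra.
split; last by right.
by rewrite /c le_max le_min sr st orbT.
Qed.

(** * The derivative along a direction *)

Section directional_derivative.
Context {R : realType} {n : nat}.
Variables (f : 'rV[R]_n -> R) (g : 'rV[R]_n -> \bar R) (e : 'rV[R]_n).
Local Open Scope ereal_scope.
Local Notation mu := (@lebesgue_measure R).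

Definition difference_quotient (k : nat) (x : 'rV[R]_n) : R :=
  (k.+1%:R * (f (x + k.+1%:R^-1 *: e) - f x))%R.

(* Truncating by [g] makes the bound hold everywhere; where the difference
   quotients converge to a limit dominated by [g], the value is that limit. *)
Definition line_derivative (x : 'rV[R]_n) : R :=
  let l := fine (limn_esup (fun k => (difference_quotient k x)%:E)) in
  if `|l|%:E <= g x then l else 0%R.

Hypotheses (mf : measurable_fun setT f) (mg : measurable_fun setT g).
Hypotheses (g0 : forall x, 0 <= g x) (e1 : (`|e| <= 1)%R).
Hypothesis fg : forall x s t, (s <= t)%R ->
  `|f (x + t *: e)%R - f (x + s *: e)%R|%:E <= \int[mu]_(r in `[s, t]) g (x + r *: e)%R.

Lemma line_derivative_le x : `|line_derivative x|%:E <= g x.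
Proof. by rewrite /line_derivative; case: ifPn => // _; rewrite normr0. Qed.

Lemma measurable_line_derivative : measurable_fun setT line_derivative.
Proof.
have ml : measurable_fun setT (fun x => fine (limn_esup (fun k => (difference_quotient k x)%:E))).
  apply: (measurableT_comp (fine_measurable measurableT)).
  apply: (measurable_fun_limn_esup (f := fun k x => (difference_quotient k x)%:E)) => k.
  apply/measurable_EFinP; apply: measurable_funM => //; apply: measurable_funB => //.
  by apply: (measurableT_comp mf); exact: measurable_translation.
apply: measurable_fun_ifT => //.
apply: measurable_fun_lee => //.
by apply/measurable_EFinP; exact: measurableT_comp.
Qed.

Lemma line_derivative_lim x l : difference_quotient k x @[k --> \oo] --> l ->
  `|l|%:E <= g x -> line_derivative x = l.
Proof.
move=> dl lg; rewrite /line_derivative.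
have -> : limn_esup (fun k => (difference_quotient k x)%:E) = l%:E.
  have dlE : (difference_quotient k x)%:E @[k --> \oo] --> l%:E.
    by apply: cvg_EFin; first exact: nearW.
  rewrite is_cvg_limn_esupE; first exact: cvg_lim dlE.
  by apply/cvg_ex; exists l%:E.
by rewrite /= lg.
Qed.

(** The one-variable result asks for an integrable bound on the whole line: [F] freezes f outside
    the segment, and [gg] is g on it, made finite, and 0 elsewhere. The bound t < r leaves room for
    s + 1/(k+1) to stay below r, where the difference quotients of [F] are those of f. *)
Let line_fundamental_pointwise x (r : R) : (0 < r)%R ->
  \int[mu]_(s in `[0%R, r]) g (x + s *: e)%R < +oo ->
  forall t, (0 <= t < r)%R ->
  (f (x + t *: e)%R - f x)%:E = \int[mu]_(s in `[0%R, t]) (line_derivative (x + s *: e)%R)%:E.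
Proof.
move=> r0 goo.
pose c (t : R) : R := Num.max 0%R (Num.min r t).
pose I := (`[0%R, r]%classic : set (measurableTypeR R)).
have mI : measurable I by exact: measurable_itv.
pose gx (s : measurableTypeR R) := g (x + s *: e)%R.
have mgx : measurable_fun setT gx by apply: (measurableT_comp mg); exact: measurable_line.
pose gg (s : R) : R := (fine (gx s) * \1_I s)%R.
pose F (t : R) := f (x + c t *: e)%R.
have mgg : measurable_fun [set: measurableTypeR R] (gg : measurableTypeR R -> R).
  apply: measurable_funM; last exact: measurable_indic.
  exact: measurableT_comp (fine_measurable measurableT) mgx.
have igx : mu.-integrable I gx.
  apply/integrableP; split; first exact: measurable_funTS.
  rewrite (_ : \int[mu]_(s in I) _ = \int[mu]_(s in I) gx s)//.
  by apply: eq_integral => s _; rewrite gee0_abs// /gx.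
have gg0 s : (0 <= gg s)%R by rewrite /gg mulr_ge0//; exact: fine_ge0 (g0 _).
have ggE : {ae mu, forall s, I s -> gx s = (gg s)%:E}.
  apply: filterS (integrable_ae mI igx) => s h Is.
  by rewrite /gg indicE mem_set// mulr1 fineK// h.
have igg : mu.-integrable setT (EFin \o gg).
  rewrite (_ : EFin \o gg = (EFin \o (fine \o gx)) \_ I).
    apply/(integrable_mkcond _ mI); apply: le_integrable igx => //.
      apply/measurable_EFinP; apply: measurable_funTS.
      exact: measurableT_comp (fine_measurable measurableT) mgx.
    move=> s _; rewrite /= /gx; have := g0 (x + s *: e)%R.
    by case: (g _) => [a| |]//= _; rewrite leey.
  apply/funext => s; rewrite patchE /= /gg indicE.
  by case: (s \in I); rewrite ?mulr1 ?mulr0.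
have Fgg s t : (s <= t)%R -> `|F t - F s|%:E <= \int[mu]_(y in `[s, t]) (gg y)%:E.
  move=> st; rewrite /F.
  have [[cst_ [cst_eq|[sc ct]]] cs0 ctr] := clamp_le r0 st.
    by rewrite /c cst_eq subrr normr0; apply: integral_ge0 => y _; rewrite lee_fin.
  have cI : `[c s, c t]%classic `<=` I.
    move=> y; rewrite /I /= !in_itv/= => /andP[y1 y2]; apply/andP; split.
      exact: le_trans cs0 y1.
    exact: le_trans y2 ctr.
  apply: le_trans (fg x cst_) _.
  rewrite (_ : \int[mu]_(y in `[c s, c t]) g (x + y *: e)%R =
    \int[mu]_(y in `[c s, c t]) (gg y)%:E); last first.
    apply: ae_eq_integral => //.
    - exact: measurable_funTS.
    - by apply/measurable_EFinP; exact: measurable_funTS.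
    - by apply: filterS ggE => y h yc; apply: h; exact: cI.
  apply: ge0_subset_integral => //.
  - by apply/measurable_EFinP; exact: measurable_funTS.
  - by move=> y _; rewrite lee_fin.
  - move=> y /=; rewrite !in_itv/= => /andP[y1 y2].
    by rewrite (le_trans sc y1) (le_trans y2 ct).
have [w [iw Fw wP]] := absolutely_continuous_derivative gg0 igg Fgg.
move=> t /andP[t0 tr].
have c0 : c 0%R = 0%R by rewrite /c min_r ?ltW// maxxx.
have ct s : (0 <= s <= r)%R -> c s = s.
  by move=> /andP[s0 sr]; rewrite /c min_r// max_r.
have -> : (f (x + t *: e)%R - f x)%:E = (F t - F 0%R)%:E.
  by rewrite /F c0 ct ?t0 ?ltW// scale0r addr0.
rewrite Fw//; apply: ae_eq_integral => //.
- by apply: measurable_funTS; have /integrableP[] := iw.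
- apply/measurable_EFinP; apply: measurable_funTS.
  by apply: (measurableT_comp measurable_line_derivative); exact: measurable_line.
apply: (@filterS _ _ (ae_filter_ringOfSetsType mu) _ _ _ wP) => s [wg dw] /=; rewrite in_itv/= => /andP[s0 st].
have sr := le_lt_trans st tr.
congr EFin; apply/esym/line_derivative_lim.
  apply: cvg_trans dw; apply: near_eq_cvg; near=> k.
  have ks : (s + k.+1%:R^-1 < r)%R.
    rewrite -ltrBrDl; near: k.
    by apply: near_infty_natSinv_lt (PosNum _); rewrite subr_gt0.
  rewrite /difference_quotient /F (ct s) ?s0 ?(ltW sr)//.
  by rewrite (ct (s + _)%R) ?(ltW ks) ?addr_ge0// scalerDl addrA.
(* Where g is infinite [gg] is 0, so [gg] never exceeds g on the segment and the truncation keeps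
   the value [w s]. *)
apply: le_trans (_ : (gg s)%:E <= _); first by rewrite lee_fin.
rewrite /gg indicE mem_set ?mulr1; last by rewrite /I/= in_itv/= s0 ltW.
by rewrite /gx; have := g0 (x + s *: e)%R; case: (g _) => [a| |]//= _; rewrite leey.
Unshelve. all: by end_near. Qed.

(** For almost every x the integral of g along the segment from x is finite, by [ae_average_lty];
    the points x + s e stay within r of x, hence the doubled radius. *)
Lemma line_fundamental x0 r : (0 < r)%R ->
  \int[leb]_(x in ball x0 (r + r)%R) g x < +oo ->
  {ae leb, forall x, ball x0 r x -> forall t, (0 <= t < r)%R ->
    (f (x + t *: e)%R - f x)%:E =
    \int[mu]_(s in `[0%R, t]) (line_derivative (x + s *: e)%R)%:E}.
Proof.
move=> r0 goo.
have mI : measurable (`[0%R, r]%classic : set (measurableTypeR R)) by exact: measurable_itv.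
have muI : mu `[0%R, r]%classic < +oo.
  by rewrite lebesgue_measure_itv/=; case: ifP => _; rewrite ?ltry.
have me : measurable_fun setT (fun s : measurableTypeR R => s *: e)%R by exact: measurable_scalerV.
have ler s : (`[0%R, r]%classic : set (measurableTypeR R)) s -> (`|s *: e| <= r)%R.
  rewrite /= in_itv/= => /andP[s0 sr]; rewrite normrZ ger0_norm//.
  by rewrite (le_trans _ sr)// ler_piMr.
apply: filterS (ae_average_lty mI muI me ler mg g0 goo) => x h xb.
exact: line_fundamental_pointwise r0 (h xb).
Qed.

End directional_derivative.

Section norm_rV.
Context {R : realType} {n : nat}.
Implicit Type v : 'rV[R]_n.

Lemma rV_coord_le_norm v i : `|v ord0 i| <= `|v|.
Proof. by rewrite [`|v|]mx_normrE; exact: (le_bigmax _ (fun ij => `|v ij.1 ij.2|) (ord0, i)). Qed.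

Lemma rV_norm_le v a : 0 <= a -> (forall i, `|v ord0 i| <= a) -> `|v| <= a.
Proof.
by move=> a0 va; rewrite [`|v|]mx_normrE; apply: bigmax_le => // -[i j] _; rewrite ord1.
Qed.

End norm_rV.

Section sigma_finite_product.
Context d1 d2 (T1 : measurableType d1) (T2 : measurableType d2) (R : realType).
Variables (m1 : {sigma_finite_measure set T1 -> \bar R})
  (m2 : {sigma_finite_measure set T2 -> \bar R}).
Local Open Scope ereal_scope.

(* The product of two measures is canonically sigma-finite in the library only
   if they are subprobabilities. *)
Definition sigma_finite_product : set (T1 * T2) -> \bar R := m1 \x m2.

HB.instance Definition _ := Measure.on sigma_finite_product.

Let product_sigma_finite : sigma_finite setT sigma_finite_product.
Proof.
have /sigma_finiteP[F [TF ndF Foo]] := sigma_finiteT m1.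
have /sigma_finiteP[G [TG ndG Goo]] := sigma_finiteT m2.
exists (fun n => F n `*` G n).
  apply/esym; rewrite -subTset => -[x y] _.
  have [i _ Fx] : (\bigcup_i F i) x by rewrite -TF.
  have [j _ Gy] : (\bigcup_i G i) y by rewrite -TG.
  exists (maxn i j) => //; split => /=.
    by move: x Fx; exact/subsetPset/ndF/leq_maxl.
  by move: y Gy; exact/subsetPset/ndG/leq_maxr.
move=> k; have [? ?] := Foo k; have [? ?] := Goo k.
split; first exact: measurableX.
by rewrite /sigma_finite_product product_measure1E// lte_mul_pinfty// ge0_fin_numE.
Qed.

HB.instance Definition _ :=
  Measure_isSigmaFinite.Build _ _ _ sigma_finite_product product_sigma_finite.

End sigma_finite_product.

(** * Local integrability of the maximal function *)

Section local_integrability.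
Context {R : realType} {n : nat}.
Local Open Scope ereal_scope.
Local Notation mu := (@lebesgue_measure R).
Local Notation e j := (basis_vector j : 'rV[R]_n).

(** The vertices of the path from 0 to v that changes one coordinate at a time. *)
Definition truncate (d : nat) (v : 'rV[R]_n) : 'rV[R]_n :=
  \row_j (if (j < d)%N then v ord0 j else 0%R).

Lemma truncate_full v : truncate n v = v.
Proof. by apply/rowP => j; rewrite mxE ltn_ord. Qed.

Lemma truncate0 v : truncate 0 v = 0%R.
Proof. by apply/rowP => j; rewrite !mxE. Qed.

Lemma truncateS (j : 'I_n) v : truncate j.+1 v = (truncate j v + v ord0 j *: e j)%R.
Proof.
apply/rowP => i; rewrite !mxE eqxx/= ltnS leq_eqVlt.
have [->|ij] := eqVneq i j; first by rewrite eqxx ltnn add0r mulr1.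
have -> : (nat_of_ord i == j) = false by apply/negbTE.
by rewrite mulr0 addr0.
Qed.

Lemma measurable_truncate d : measurable_fun setT (truncate d).
Proof.
apply: measurable_fun_rV => j; under eq_fun do rewrite mxE.
by case: (j < d)%N; [exact: measurable_coord|exact: measurable_cst].
Qed.

Lemma ae_ball_exists (Q : 'rV[R]_n -> Prop) x0 r : (0 < r)%R ->
  {ae leb, forall x, Q x} -> exists2 x, ball x0 r x & Q x.
Proof.
move=> r0 [N [mN N0 QN]]; apply: contrapT => h.
have : leb (ball x0 r) <= leb N.
  apply: le_measure; rewrite ?inE//; first exact: measurable_ball_rV.
  by move=> x xb; apply: QN => Qx; apply: h; exists x.
by rewrite N0 leb_ball// lee_fin leNgt exprn_gt0// pmulrn_rgt0.
Qed.

Variables (f : 'rV[R]_n -> \bar R) (g : 'I_n -> 'rV[R]_n -> \bar R).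
Hypotheses (mf : measurable_fun setT f) (f0 : forall x, 0 <= f x).
Hypothesis foo : {ae leb, forall x, f x < +oo}.
Hypotheses (mg : forall j, measurable_fun setT (g j)) (g0 : forall j x, 0 <= g j x).
Hypothesis fg : forall j x s t, (s <= t)%R ->
  f (x + t *: e j)%R <= f (x + s *: e j)%R + \int[mu]_(r in `[s, t]) g j (x + r *: e j)%R.
Hypothesis gf : forall j x s t, (s <= t)%R ->
  f (x + s *: e j)%R <= f (x + t *: e j)%R + \int[mu]_(r in `[s, t]) g j (x + r *: e j)%R.

(** Integrating over all of [-a, a] removes t from the right side, so that for t a coordinate of v
    the bound depends only on the vertex already reached. *)
Let step j x (a t : R) : (`|t| <= a)%R ->
  f (x + t *: e j)%R <= f x + \int[mu]_(r in `[(- a)%R, a]) g j (x + r *: e j)%R.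
Proof.
move=> /[dup] ta; rewrite ler_norml => /andP[at_ ta'].
have mgx : measurable_fun [set: measurableTypeR R] (fun r => g j (x + r *: e j)%R).
  by apply: (measurableT_comp (mg j)); exact: measurable_line.
have sub (c d : R) : (- a <= c)%R -> (d <= a)%R ->
    \int[mu]_(r in `[c, d]) g j (x + r *: e j)%R <=
    \int[mu]_(r in `[(- a)%R, a]) g j (x + r *: e j)%R.
  move=> ac da; apply: ge0_subset_integral => //; first exact: measurable_funTS.
  move=> y /=; rewrite !in_itv/= => /andP[cy yd].
  by rewrite (le_trans ac cy) (le_trans yd da).
have a0 : (0 <= a)%R by exact: le_trans ta.
have [t0|/ltW t0] := leP 0%R t.
  apply: le_trans (fg j x t0) _; rewrite scale0r addr0 leeD2l// sub//.
  by rewrite oppr_le0.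
apply: le_trans (gf j x t0) _; rewrite scale0r addr0 leeD2l// sub//.
Qed.

(** Almost every x in the cube has f x finite and finite integrals of all g_j over the edges of the
    paths that start at x. For one such x, adding edges one coordinate at a time shows that f(x + v)
    is integrable in v, and the points x + v cover the cube. *)
Lemma ball_integral_lty x0 (r : R) : (0 < r)%R ->
  (forall j, \int[leb]_(x in ball x0 (r + r *+ 2)%R) g j x < +oo) ->
  \int[leb]_(x in ball x0 r) f x < +oo.
Proof.
(* Two points of the cube of radius r differ by less than 2 r, so v in the cube of radius [a] around
   0 reaches all of it from x. *)
move=> r0 goo; pose a := (r *+ 2)%R.
have a0 : (0 < a)%R by rewrite pmulrn_rgt0.
pose B : set 'rV[R]_n := ball 0%R a.
pose I := (`[(- a)%R, a]%classic : set (measurableTypeR R)).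
have coord_le v i : B v -> (`|v ord0 i| <= a)%R.
  rewrite /B mx_norm_ball /ball_ /= sub0r normrN => /ltW; apply: le_trans.
  exact: rV_coord_le_norm.
have mI : measurable I by exact: measurable_itv.
have mB : measurable B by exact: measurable_ball_rV.
pose W (j : 'I_n) (z : 'rV[R]_n * measurableTypeR R) := (truncate j z.1 + z.2 *: e j)%R.
have mW j : measurable_fun setT (W j).
  apply: measurable_addrV.
    by apply: (measurableT_comp (measurable_truncate j)); exact: measurable_fst.
  by apply: measurable_scalerV; exact: measurable_snd.
(* The edge runs in a coordinate that [truncate j] has set to 0, so in the sup norm the point stays
   within [a], whatever the dimension. *)
have Wa j z : (B `*` I) z -> (`|W j z| <= a)%R.
  move=> [/= zB]; rewrite /I /= in_itv/= -ler_norml => z2.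
  apply: rV_norm_le => [|i]; first exact: ltW.
  rewrite !mxE eqxx/=; have [->|ij] := eqVneq i j.
    by rewrite ltnn add0r mulr1.
  rewrite mulr0 addr0; case: ifP => _; last by rewrite normr0 ltW.
  exact: coord_le.
have lB : leb B \is a fin_num by rewrite /B leb_ball.
have muI : mu I < +oo.
  by rewrite lebesgue_measure_itv/=; case: ifP => _; rewrite ?ltry.
have PD : sigma_finite_product leb mu (B `*` I) < +oo.
  by rewrite /sigma_finite_product product_measure1E// lte_mul_pinfty.
have good : {ae leb, forall x, f x < +oo /\ forall j, ball x0 r x ->
    \int[sigma_finite_product leb mu]_(z in B `*` I) g j (x + W j z)%R < +oo}.
  apply: (@filterI _ _ (ae_filter_ringOfSetsType leb)) => //.
  apply: (@filter_forall _ _ (fun j x => ball x0 r x ->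
    \int[sigma_finite_product leb mu]_(z in B `*` I) g j (x + W j z)%R < +oo)
    _ (ae_filter_ringOfSetsType leb)) => j.
  exact: (ae_average_lty (measurableX mB mI) PD (mW j) (Wa j) (mg j) (g0 j) (goo j)).
have [x xb [fx gx]] := ae_ball_exists x0 r0 good.
have mfx d : measurable_fun setT (fun v => f (x + truncate d v)%R).
  by apply: (measurableT_comp mf); apply: measurable_addrV => //; exact: measurable_truncate.
have fd d : (d <= n)%N -> \int[leb]_(v in B) f (x + truncate d v)%R < +oo.
  elim: d => [_|d IH dn].
    under eq_integral do rewrite truncate0 addr0.
    by rewrite integral_cst// lte_mul_pinfty// ?ge0_fin_numE// -ge0_fin_numE.
  pose j := Ordinal dn.
  pose G v := \int[mu]_(s in I) g j (x + W j (v, s))%R.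
  have mgW : measurable_fun setT (fun z => g j (x + W j z)%R).
    by apply: (measurableT_comp (mg j)); exact: measurable_addrV.
  have mG : measurable_fun setT G.
    exact: (measurable_tonelli1_in mu mI mgW (fun z => g0 _ _)).
  apply: (@le_lt_trans _ _ (\int[leb]_(v in B) (f (x + truncate d v)%R + G v))).
    apply: ge0_le_integral => //.
    - exact: measurable_funTS.
    - by apply: measurable_funTS; exact: emeasurable_funD.
    move=> v vB; rewrite (truncateS j) addrA.
    under [G v]eq_integral do rewrite /W/= addrA.
    by apply: step; exact: coord_le.
  rewrite ge0_integralD//; last 3 first.
  - exact: measurable_funTS.
  - by move=> v _; apply: integral_ge0 => s _; exact: g0.
  - exact: measurable_funTS.
  rewrite lte_add_pinfty//; first exact/IH/ltnW.
  rewrite -(tonelli1_in leb mu mB mI mgW)//; exact: gx.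
have := fd n (leqnn n).
under eq_integral do rewrite truncate_full addrC.
rewrite (integral_ball_translation x 0%R a mf f0) add0r; apply: le_lt_trans.
apply: ge0_subset_integral => //; try exact: measurable_ball_rV.
  exact: measurable_funTS.
move=> y; move: xb; rewrite !mx_norm_ball /ball_ /= => xb yb.
rewrite -(subrK x0 x) -addrA /a mulr2n; apply: le_lt_trans (ler_normD _ _) _.
by rewrite ltrD// distrC.
Qed.

End local_integrability.

(** * Integration by parts *)

Section segment_integral.
Context {R : realType} {n : nat}.
Variables (e : 'rV[R]_n) (psi : 'rV[R]_n -> R) (C : R).
Hypotheses (mpsi : measurable_fun setT psi) (psiC : forall x, `|psi x| <= C).
Local Open Scope ereal_scope.
Local Notation mu := (@lebesgue_measure R).

(** Divided by t, the mean of psi over the segment from x back to x - t e. Fubini turns the test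
    function into this when an increment of F is written as an integral of H. *)
Definition segment_integral (t : R) (x : 'rV[R]_n) : R :=
  fine (\int[mu]_(s in `[0%R, t]) (psi (x - s *: e)%R)%:E).

Let mI (t : R) : measurable (`[0%R, t]%classic : set (measurableTypeR R)).
Proof. exact: measurable_itv. Qed.

Let mpsi2 : measurable_fun [set: 'rV[R]_n * measurableTypeR R]
  (fun z => (psi (z.1 - z.2 *: e)%R)%:E).
Proof.
apply/measurable_EFinP; apply: (measurableT_comp mpsi).
apply: measurable_addrV; first exact: measurable_fst.
under eq_fun do rewrite -scaleNr.
by apply: measurable_scalerV; apply: measurableT_comp => //; exact: measurable_snd.
Qed.

Let mpsi1 x : measurable_fun [set: measurableTypeR R]
  (fun s : measurableTypeR R => (psi (x - s *: e)%R)%:E).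
Proof. exact: measurableT_comp mpsi2 (measurable_pair1 x). Qed.

Lemma integrable_cst_itv (t c : R) :
  mu.-integrable (`[0%R, t]%classic : set (measurableTypeR R)) (cst c%:E).
Proof.
apply/integrableP; split; first exact: measurable_cst.
rewrite [X in X < _](_ : _ = \int[mu]_(x in `[0%R, t]) cst `|c|%:E x)//.
rewrite integral_cst// lte_mul_pinfty//.
have : mu `[0%R, t]%classic < +oo by rewrite lebesgue_measure_itv/=; case: ifP => _; rewrite ?ltry.
exact.
Qed.

Lemma integrable_segment t x :
  mu.-integrable (`[0%R, t]%classic : set (measurableTypeR R)) (fun s => (psi (x - s *: e)%R)%:E).
Proof.
apply: le_integrable (integrable_cst_itv t C) => //; first exact: measurable_funTS.
by move=> s _ /=; rewrite lee_fin (le_trans (psiC _))// ler_norm.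
Qed.

Lemma segment_integralE t x :
  (segment_integral t x)%:E = \int[mu]_(s in `[0%R, t]) (psi (x - s *: e)%R)%:E.
Proof.
by rewrite /segment_integral fineK//; apply: integrable_fin_num => //; exact: integrable_segment.
Qed.

Lemma segment_integral_between t x m M : (0 < t)%R ->
  (forall s, 0 <= s <= t -> m <= psi (x - s *: e) <= M)%R ->
  (m * t <= segment_integral t x <= M * t)%R.
Proof.
move=> t0 mM.
have E c : \int[mu]_(s in `[0%R, t]) cst c%:E s = (c * t)%:E.
  transitivity (c%:E * mu `[0%R, t]%classic); first exact: integral_cst.
  by rewrite lebesgue_measure_itv/= lte_fin t0 sube0 -EFinM.
apply/andP; split; rewrite -lee_fin segment_integralE -E; apply: le_integral => //;
  try exact: integrable_cst_itv; try exact: integrable_segment.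
- by move=> s; rewrite inE/= in_itv/= => /mM/andP[]; rewrite lee_fin.
- by move=> s; rewrite inE/= in_itv/= => /mM/andP[]; rewrite lee_fin.
Qed.

Lemma measurable_segment_integral t : measurable_fun setT (segment_integral t).
Proof.
apply/(measurableT_comp (fine_measurable measurableT)).
under eq_fun do rewrite integralE.
have mpos := measurable_funepos mpsi2; have mneg := measurable_funeneg mpsi2.
have pos0 z : 0 <= (fun z : 'rV[R]_n * measurableTypeR R => (psi (z.1 - z.2 *: e)%R)%:E)^\+ z.
  by rewrite funeposE le_max lexx orbT.
have neg0 z : 0 <= (fun z : 'rV[R]_n * measurableTypeR R => (psi (z.1 - z.2 *: e)%R)%:E)^\- z.
  by rewrite funenegE le_max lexx orbT.
apply: emeasurable_funB.
- apply: eq_measurable_fun (measurable_tonelli1_in mu (mI t) mpos pos0) => x _.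
  by apply: eq_integral => s _; rewrite !funeposE.
- apply: eq_measurable_fun (measurable_tonelli1_in mu (mI t) mneg neg0) => x _.
  by apply: eq_integral => s _; rewrite !funenegE.
Qed.

Lemma segment_average_between (k : nat) x m M :
  (forall s, 0 <= s <= k.+1%:R^-1 -> m <= psi (x - s *: e) <= M)%R ->
  (m <= k.+1%:R * segment_integral k.+1%:R^-1 x <= M)%R.
Proof.
move=> mM; have k0 : (0 < k.+1%:R^-1 :> R)%R by rewrite invr_gt0.
have := segment_integral_between k0 mM.
by rewrite ler_pdivrMr// ler_pdivlMr// mulrC.
Qed.

Lemma segment_average_le (k : nat) x :
  (`|k.+1%:R * segment_integral k.+1%:R^-1 x| <= C)%R.
Proof.
by rewrite ler_norml; apply: segment_average_between => s _; rewrite -ler_norml.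
Qed.

Lemma segment_average_cvg x : {for x, continuous psi} ->
  (k.+1%:R * segment_integral k.+1%:R^-1 x)%R @[k --> \oo] --> psi x.
Proof.
move=> cpsi; apply/cvgrPdist_le => eps eps0.
have : \forall s \near (0:R)%R, (`|psi x - psi (x - s *: e)| <= eps)%R.
  have c : psi (x - s *: e)%R @[s --> (0:R)%R] --> psi x.
    apply: (@cvg_comp _ _ _ (fun s : R => x - s *: e)%R psi _ (nbhs x)) => //.
    have -> : nbhs x = nbhs (x - 0 *: e)%R by rewrite scale0r subr0.
    by apply: cvgB; [exact: cvg_cst|apply: cvgZr_tmp; exact: cvg_id].
  by move/cvgrPdist_le : c; exact.
case=> d /= d0 dP; near=> k.
have kd : (k.+1%:R^-1 < d)%R by near: k; exact: near_infty_natSinv_lt (PosNum d0).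
rewrite distrC ler_distl; apply: segment_average_between => s /andP[s0 sk].
rewrite -ler_distl distrC; apply: dP => /=.
by rewrite sub0r normrN ger0_norm// (le_lt_trans sk).
Unshelve. all: by end_near. Qed.

Lemma integral_segment_average_cvg (F : 'rV[R]_n -> R) :
  leb.-integrable setT (EFin \o F) -> continuous psi ->
  \int[leb]_x (F x * (k.+1%:R * segment_integral k.+1%:R^-1 x))%:E @[k --> \oo] -->
  \int[leb]_x (F x * psi x)%:E.
Proof.
move=> /[dup] iF /integrableP[/measurable_EFinP mF _] cpsi.
have := @dominated_convergence _ _ _ (@leb R n) setT measurableT
  (fun k x => (F x * (k.+1%:R * segment_integral k.+1%:R^-1 x))%:E)
  (fun x => (F x * psi x)%:E) (fun x => C%:E * `|(F x)%:E|).
case => //.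
- move=> k; apply/measurable_EFinP; apply: measurable_funM => //.
  by apply: measurable_funM => //; exact: measurable_segment_integral.
- by apply/measurable_EFinP; exact: measurable_funM.
- apply: (@aeW _ _ _ leb) => x _; apply: cvg_EFin; first exact: nearW.
  by apply: cvgM; [exact: cvg_cst|apply: segment_average_cvg; exact: cpsi].
- by apply: integrableZl => //; exact: integrable_abse.
- apply: (@aeW _ _ _ leb) => x k _.
  by rewrite -!EFinM lee_fin normrM mulrC ler_wpM2r// segment_average_le.
Qed.

End segment_integral.

Section integration_by_parts.
Context {R : realType} {n : nat} (i : 'I_n).
Variables (F H phi : 'rV[R]_n -> R).
Local Open Scope ereal_scope.
Local Notation mu := (@lebesgue_measure R).
Local Notation e := (basis_vector i : 'rV[R]_n).
Hypotheses (iF : leb.-integrable setT (EFin \o F)) (iH : leb.-integrable setT (EFin \o H)).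
Hypothesis tphi : test_function phi.

Let mH : measurable_fun setT H.
Proof. by move/integrableP : iH => [/measurable_EFinP]. Qed.

Let mF : measurable_fun setT F.
Proof. by move/integrableP : iF => [/measurable_EFinP]. Qed.

Let mphi : measurable_fun setT phi := measurable_test_function tphi.

Section increments.
Variable t : R.
Hypothesis FH : {ae leb, forall x, supp phi x ->
  (F (x + t *: e) - F x)%:E = \int[mu]_(s in `[0%R, t]) (H (x + s *: e)%R)%:E}.

Let mI : measurable (`[0%R, t]%classic : set (measurableTypeR R)).
Proof. exact: measurable_itv. Qed.

Let muI : mu `[0%R, t]%classic < +oo.
Proof. by rewrite lebesgue_measure_itv/=; case: ifP => _; rewrite ?ltry. Qed.

Let T : {finite_measure set (measurableTypeR R) -> \bar R} := mfrestr mI muI.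

Let Too : T setT < +oo.
Proof. by rewrite -ge0_fin_numE// fin_num_measure. Qed.

Let H1 (z : 'rV[R]_n * measurableTypeR R) : R := H z.1.
Let H2 (z : 'rV[R]_n * measurableTypeR R) : R := H (z.1 + z.2 *: e).

Let mH1 : measurable_fun setT H1.
Proof. by apply: measurableT_comp => //; exact: measurable_fst. Qed.

Let mshift : measurable_fun [set: 'rV[R]_n * measurableTypeR R]
  (fun z => z.1 + z.2 *: e)%R.
Proof.
apply: measurable_addrV; first exact: measurable_fst.
by apply: measurable_scalerV; exact: measurable_snd.
Qed.

Let mshiftN : measurable_fun [set: 'rV[R]_n * measurableTypeR R]
  (fun z => z.1 - z.2 *: e)%R.
Proof.
apply: measurable_addrV; first exact: measurable_fst.
under eq_fun do rewrite -scaleNr.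
by apply: measurable_scalerV; apply: measurableT_comp => //; exact: measurable_snd.
Qed.

Let mH2 : measurable_fun setT H2.
Proof. exact: measurableT_comp mH mshift. Qed.

Let normH_lty : \int[leb]_x `|(H x)%:E| < +oo.
Proof. by move/integrableP : iH => []. Qed.

Let cst_lty (c : \bar R) : 0 <= c -> c < +oo -> \int[T]_s cst c s < +oo.
Proof. by move=> c0 coo; rewrite integral_cst// lte_mul_pinfty// ge0_fin_numE. Qed.

Let iH2 : (leb \x T).-integrable setT (EFin \o H2).
Proof.
apply/integrable21ltyP; first exact/measurable_EFinP.
rewrite [X in X < _](_ : _ = \int[T]_s cst (\int[leb]_x `|(H x)%:E|) s).
  by apply: cst_lty => //; exact: integral_ge0.
apply: eq_integral => s _.
rewrite -[RHS](ge0_integral_translation (s *: e))//.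
by apply: measurableT_comp => //; exact/measurable_EFinP.
Qed.

Let iH1 : (leb \x T).-integrable setT (EFin \o H1).
Proof.
apply/integrable21ltyP; first exact/measurable_EFinP.
rewrite [X in X < _](_ : _ = \int[T]_s cst (\int[leb]_x `|(H x)%:E|) s)//.
by apply: cst_lty => //; exact: integral_ge0.
Qed.

(** A discrete integration by parts: translation moves the increment from phi to F, [FH] writes it
    as an integral of H, and translating back inside Fubini puts the shift on phi. Off the support
    of phi both integrands vanish, so [FH] is asked for on the support only. *)
Lemma integral_increment :
  \int[leb]_x (F x * (phi x - phi (x - t *: e)))%:E =
  - \int[leb]_x (H x * segment_integral e phi t x)%:E.
Proof.
have [C [C0 phiC]] := test_function_bounded tphi.
have iFphi c : leb.-integrable setT (fun x => (F x * phi (x - c)%R)%:E).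
  by apply: (integrable_mul_bounded iF _ (fun x => phiC _)); exact: measurableT_comp mphi (measurable_translation _).
have iFphi0 : leb.-integrable setT (fun x => (F x * phi x)%:E).
  exact: (integrable_mul_bounded iF mphi phiC).
have iFt : leb.-integrable setT (EFin \o (fun x => F (x + t *: e)%R)).
  exact: integrable_translation iF.
have iFtphi : leb.-integrable setT (fun x => (F (x + t *: e)%R * phi x)%:E).
  exact: (integrable_mul_bounded iFt mphi phiC).
have incr : \int[leb]_x (F x * (phi x - phi (x - t *: e)))%:E =
    - \int[leb]_x ((F (x + t *: e) - F x) * phi x)%:E.
  under eq_integral do rewrite mulrBr EFinB.
  rewrite integralB//.
  under [in RHS]eq_integral do rewrite mulrBl EFinB.
  rewrite integralB// fin_num_oppeB; last exact: integrable_fin_num.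
  rewrite addeC; congr (_ + _); congr (- _).
  rewrite -[LHS](integral_translation (t *: e)); last exact: measurable_int (iFphi _).
  by apply: eq_integral => x _; rewrite addrK.
rewrite incr; congr (- _).
have iH2phi : (leb \x T).-integrable setT (fun z => (H2 z * phi z.1)%:E).
  apply: (integrable_mul_bounded iH2 _ (fun x => phiC _)).
  by apply: measurableT_comp mphi _; exact: measurable_fst.
have iH1phi : (leb \x T).-integrable setT (fun z => (H1 z * phi (z.1 - z.2 *: e)%R)%:E).
  by apply: (integrable_mul_bounded iH1 _ (fun x => phiC _)); exact: measurableT_comp mphi mshiftN.
transitivity (\int[leb]_x \int[T]_s (H2 (x, s) * phi x)%:E).
  apply: ae_eq_integral => //.
  - apply/measurable_EFinP; apply: measurable_funM => //; apply: measurable_funB => //.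
    exact: measurableT_comp mF (measurable_translation _).
  - exact: measurable_fubini_F iH2phi.
  apply: (@filterS2 _ _ (ae_filter_ringOfSetsType leb) _ _ _ _ FH (ae_integrable1 iH2)) => x FHx iHx _.
  have [xK|xK] := pselect (supp phi x); last first.
    rewrite (out_supp xK) mulr0 integral0_eq// => s _.
    by rewrite mulr0.
  under [RHS]eq_integral do rewrite EFinM muleC.
  rewrite integralZl// EFinM muleC; congr (_ * _).
  rewrite FHx// -(integral_mfrestr mI muI)//.
  by apply/measurable_EFinP; apply: measurableT_comp mH _; exact: measurable_line.
rewrite (Fubini iH2phi).
transitivity (\int[T]_s \int[leb]_x (H1 (x, s) * phi (x - s *: e)%R)%:E).
  apply: eq_integral => s _.
  rewrite -[RHS](integral_translation (s *: e)).
    by apply: eq_integral => x _; rewrite /= addrK.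
  apply/measurable_EFinP; apply: measurable_funM => //.
  by apply: measurableT_comp mphi _; exact: (measurable_translation (- (s *: e))%R).
rewrite -(Fubini iH1phi); apply: eq_integral => x _.
rewrite EFinM (segment_integralE e mphi phiC) /=.
under eq_integral do rewrite EFinM.
have mphix : measurable_fun [set: measurableTypeR R]
    (fun s : measurableTypeR R => (phi (x - s *: e)%R)%:E).
  by apply/measurable_EFinP; exact: measurableT_comp mphi (measurableT_comp mshiftN (measurable_pair1 x)).
rewrite /H1 /= integralZl ?(integral_mfrestr mI muI)//.
apply: (@le_integrable _ _ _ T _ _ _ (cst C%:E)) => //.
  by move=> s _; rewrite /= lee_fin (le_trans (phiC _))// ler_norm.
exact: finite_measure_integrable_cst.
Qed.

End increments.

(** Take [integral_increment] at t = 1/(k+1), times k+1. The increment of phi is the segment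
    integral of [partial i phi], so both sides pair an integrable function with segment means, and
    one convergence lemma gives both limits. *)
Lemma integral_by_parts (rho : R) : (0 < rho)%R ->
  (forall t, (0 <= t < rho)%R -> {ae leb, forall x, supp phi x ->
    (F (x + t *: e) - F x)%:E = \int[mu]_(s in `[0%R, t]) (H (x + s *: e)%R)%:E}) ->
  - (\int[leb]_x (F x * partial i phi x)%:E) = \int[leb]_x (H x * phi x)%:E.
Proof.
move=> rho0 FH.
have tdphi := test_function_partial i tphi.
have [C [C0 phiC]] := test_function_bounded tphi.
have [C' [C'0 dphiC]] := test_function_bounded tdphi.
have mdphi := measurable_test_function tdphi.
have cF := integral_segment_average_cvg e mdphi dphiC iF (smooth_continuous tdphi.1).
have cH := integral_segment_average_cvg e mphi phiC iH (smooth_continuous tphi.1).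
have idphi : \int[leb]_x (F x * partial i phi x)%:E \is a fin_num.
  by apply: integrable_fin_num => //; exact: (integrable_mul_bounded iF mdphi dphiC).
move/cvgeN : cF => cF.
apply: (cvg_unique (@ereal_hausdorff R) cF).
apply: cvg_trans cH; apply: near_eq_cvg; near=> k.
have k0 : (0 <= k.+1%:R^-1 :> R)%R by rewrite invr_ge0.
have krho : (k.+1%:R^-1 < rho)%R by near: k; exact: near_infty_natSinv_lt (PosNum rho0).
have incr := integral_increment (FH _ (introT andP (conj k0 krho))).
have avg (G f : 'rV[R]_n -> R) (A : R) :
    leb.-integrable setT (EFin \o G) -> measurable_fun setT f ->
    (forall x, (`|k.+1%:R * f x| <= A)%R) ->
    \int[leb]_x (G x * (k.+1%:R * f x))%:E = k.+1%:R%:E * \int[leb]_x (G x * f x)%:E.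
  move=> iG mf fA; under eq_integral do rewrite mulrCA EFinM.
  rewrite integralZl//; apply: (integrable_mul_bounded iG mf) => x.
  by apply: le_trans (fA x); rewrite normrM ler_peMl// ger0_norm// ler1n.
rewrite (avg _ _ _ iF (measurable_segment_integral e mdphi _) (segment_average_le e mdphi dphiC k)).
rewrite (avg _ _ _ iH (measurable_segment_integral e mphi _) (segment_average_le e mphi phiC k)).
rewrite -muleN; congr (_ * _); rewrite -[LHS]oppeK -incr; congr (- _).
apply: eq_integral => x _; congr EFin; congr (_ * _)%R; apply: EFin_inj.
by rewrite (segment_integralE e mdphi dphiC) smooth_FTC// ?scale0r ?subr0//; case: tphi.
Unshelve. all: by end_near. Qed.

End integration_by_parts.

(** * Localisation of the integration by parts *)

Section local_integration_by_parts.
Import finmap.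
Context {R : realType} {n : nat}.
Local Open Scope ereal_scope.

Lemma exists_lower_bound (T : eqType) (s : seq T) (r : T -> R) :
  (forall x, (0 < r x)%R) -> exists2 rho : R, (0 < rho)%R & {in s, forall x, (rho <= r x)%R}.
Proof.
move=> r0; elim: s => [|y s [rho rho0 IH]]; first by exists 1%R.
exists (Num.min (r y) rho); first by rewrite lt_min r0.
by move=> x; rewrite inE ge_min => /predU1P[->|/IH ->]; rewrite ?lexx ?orbT.
Qed.

Lemma integral_bigU_lty (T : eqType) (s : seq T) (B : T -> set 'rV[R]_n)
    (g : 'rV[R]_n -> \bar R) :
  measurable_fun setT g -> (forall x, 0 <= g x) ->
  (forall t, measurable (B t)) ->
  {in s, forall t, \int[leb]_(x in B t) g x < +oo} ->
  \int[leb]_(x in \big[setU/set0]_(t <- s) B t) g x < +oo.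
Proof.
move=> mg g0 mB; elim: s => [_|y s IH H]; first by rewrite big_nil integral_set0.
have mU : measurable (\big[setU/set0]_(t <- s) B t) by exact: bigsetU_measurable.
rewrite big_cons.
apply: (@le_lt_trans _ _ (density leb mg g0 (B y) + density leb mg g0 (\big[setU/set0]_(t <- s) B t))).
  exact: (@measureU2 _ _ _ (density leb mg g0)).
rewrite /density lte_add_pinfty//; first by apply: H; rewrite mem_head.
by apply: IH => t ts; apply: H; rewrite inE ts orbT.
Qed.

Lemma integrable_indic (f : 'rV[R]_n -> R) (V : set 'rV[R]_n) :
  measurable_fun setT f -> measurable V -> \int[leb]_(x in V) `|f x|%:E < +oo ->
  leb.-integrable setT (EFin \o (fun x => f x * \1_V x)%R).
Proof.
move=> mf mV foo; apply/integrableP; split.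
  by apply/measurable_EFinP; apply: measurable_funM => //; exact: measurable_indic.
rewrite (_ : \int[leb]_x _ = \int[leb]_(x in V) `|f x|%:E)//.
rewrite [RHS]integral_mkcond; apply: eq_integral => x _.
by rewrite /= patchE indicE; case: (x \in V); rewrite ?mulr1// mulr0 normr0.
Qed.

Variables (i : 'I_n) (f : 'rV[R]_n -> R) (g : 'rV[R]_n -> \bar R) (phi : 'rV[R]_n -> R).
Local Notation e := (basis_vector i : 'rV[R]_n).
Local Notation mu := (@lebesgue_measure R).
Local Notation h := (line_derivative f g e).
Hypotheses (mf : measurable_fun setT f) (mg : measurable_fun setT g) (g0 : forall x, 0 <= g x).
Hypothesis fg : forall x s t, (s <= t)%R ->
  `|f (x + t *: e)%R - f (x + s *: e)%R|%:E <= \int[mu]_(r in `[s, t]) g (x + r *: e)%R.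
Hypothesis tphi : test_function phi.
Hypothesis loc : forall x, supp phi x -> exists2 r : R, (0 < r)%R &
  \int[leb]_(y in ball x r) g y < +oo /\ \int[leb]_(y in ball x r) `|f y|%:E < +oo.

Lemma norm_basis_vector : (`|e| <= 1)%R.
Proof.
apply: rV_norm_le => // j; rewrite mxE eqxx/=.
by case: (j == i); rewrite ?normr1 ?normr0.
Qed.

(** Multiplying f and h by the indicator of a neighbourhood V of the support makes them integrable
    and leaves the integrals against phi unchanged. By compactness V is a finite union of cubes; as
    half their radii already cover the support, segments shorter than [rho] issuing from it stay in
    V, where the cut-off is invisible. *)
Lemma local_integral_by_parts :
  [/\ leb.-integrable setT (fun x => (f x * partial i phi x)%:E),
      leb.-integrable setT (fun x => (h x * phi x)%:E) &
      - (\int[leb]_x (f x * partial i phi x)%:E) = \int[leb]_x (h x * phi x)%:E].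
Proof.
have mh := measurable_line_derivative e mf mg.
have hg x : `|h x|%:E <= g x by exact: line_derivative_le.
have /choice[rr rrP] : forall x, exists r : R, (0 < r)%R /\ (supp phi x ->
    \int[leb]_(y in ball x r) g y < +oo /\ \int[leb]_(y in ball x r) `|f y|%:E < +oo).
  move=> x; have [/loc[r r0 H]|xK] := pselect (supp phi x); first by exists r.
  by exists 1%R; split.
have rr0 x : (0 < rr x / 2)%R by rewrite divr_gt0//; case: (rrP x).
have rr2 x : (rr x / 2 + rr x / 2)%R = rr x by rewrite -splitr.
have := tphi.2; rewrite compact_cover => /(_ _ (supp phi) (fun x => ball x (rr x / 2)%R)).
case=> [x _|x xK|D DK KD]; first exact: ball_open.
  by exists x => //; exact: ballxx.
have [rho rho0 rhoD] := exists_lower_bound (enum_fset D) rr0.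
pose V : set 'rV[R]_n := \big[setU/set0]_(x <- enum_fset D) ball x (rr x).
have mV : measurable V by apply: bigsetU_measurable => x _; exact: measurable_ball_rV.
have VP y x : y \in D -> ball y (rr y) x -> V x.
  by move=> yD yx; rewrite /V -bigcup_seq; exists y.
have mb t : measurable (ball t (rr t) : set 'rV[R]_n) by exact: measurable_ball_rV.
have mabs (k : 'rV[R]_n -> R) : measurable_fun setT k -> measurable_fun setT (fun x => `|k x|%:E).
  by move=> mk; apply/measurable_EFinP; exact: measurableT_comp.
have goo : \int[leb]_(x in V) g x < +oo.
  apply: integral_bigU_lty => // t tD.
  by have [_] := rrP t; case => //; apply/set_mem/DK.
have foo : \int[leb]_(x in V) `|f x|%:E < +oo.
  apply: integral_bigU_lty => // [|t tD]; first exact: mabs.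
  by have [_] := rrP t; case => //; apply/set_mem/DK.
have hoo : \int[leb]_(x in V) `|h x|%:E < +oo.
  apply: le_lt_trans goo; apply: ge0_le_integral => //.
  - by apply: measurable_funTS; exact: mabs.
  - exact: measurable_funTS.
have KV x : supp phi x -> V x.
  move=> /KD[y /= yD yx]; apply: (VP y) => //.
  by apply: le_ball yx; rewrite -[leRHS]rr2 lerDl ltW.
have iF := integrable_indic mf mV foo; have iH := integrable_indic mh mV hoo.
have [C [C0 phiC]] := test_function_bounded tphi.
have [C' [C'0 dphiC]] := test_function_bounded (test_function_partial i tphi).
have mphi := measurable_test_function tphi.
have mdphi := measurable_test_function (test_function_partial i tphi).
have Fphi : (fun x => (f x * partial i phi x)%:E) =
    (fun x => (f x * \1_V x * partial i phi x)%:E).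
  apply/funext => x; have [xK|xK] := pselect (supp phi x).
    by rewrite indicE mem_set ?mulr1//; exact: KV.
  by rewrite partial_out_supp// !mulr0.
have Hphi : (fun x => (h x * phi x)%:E) = (fun x => (h x * \1_V x * phi x)%:E).
  apply/funext => x; have [xK|xK] := pselect (supp phi x).
    by rewrite indicE mem_set ?mulr1//; exact: KV.
  by rewrite (out_supp xK) !mulr0.
rewrite Fphi Hphi; split.
- exact: (integrable_mul_bounded iF mdphi dphiC).
- exact: (integrable_mul_bounded iH mphi phiC).
apply: (integral_by_parts iF iH tphi rho0) => t /andP[t0 trho].
(* One exceptional null set for each cube of the cover; indexing by the finite type of [D] allows
   their union to be taken afterwards. *)
have ftc (y : D) : {ae leb, forall x, ball (val y) (rr (val y) / 2)%R x ->
    forall t, (0 <= t < rr (val y) / 2)%R -> (f (x + t *: e)%R - f x)%:E =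
    \int[mu]_(s in `[0%R, t]) (h (x + s *: e)%R)%:E}.
  apply: (line_fundamental mf mg g0 norm_basis_vector fg (rr0 _)).
  by rewrite rr2; have [_] := rrP (val y); case => //; apply/set_mem/DK; exact: valP.
have := @filter_forall _ _ _ _ (ae_filter_ringOfSetsType leb) ftc.
apply: (@filterS _ _ (ae_filter_ringOfSetsType leb)) => x ftcx /KD[y /= yD yx].
have tr : (t < rr y / 2)%R by apply: lt_le_trans (rhoD y yD).
have := ftcx [` yD]%fset; rewrite /= => /(_ yx t); rewrite t0 tr => /(_ isT).
have xV s : (0 <= s <= t)%R -> \1_V (x + s *: e)%R = 1%R :> R.
  move=> /andP[s0 st]; rewrite indicE mem_set//; apply: (VP y) => //.
  move: yx; rewrite !mx_norm_ball /ball_ /= => yx.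
  rewrite opprD addrA -[ltRHS]rr2; apply: le_lt_trans (ler_normB _ _) _.
  rewrite ltr_leD// (le_trans _ (ltW tr))// normrZ ger0_norm//.
  by rewrite (le_trans _ st)// ler_piMr// norm_basis_vector.
rewrite xV ?t0 ?lexx// mulr1.
have -> : \1_V x = 1%R :> R by rewrite -[x]addr0 -(scale0r e) xV ?lexx.
rewrite mulr1 => ->; apply: eq_integral => s /set_mem /=; rewrite in_itv/= => st.
by rewrite xV// mulr1.
Qed.

End local_integration_by_parts.

(** * The maximal function of a function of bounded variation *)

Section variation.
Context {R : realType} {n : nat} (Du : vector_measure R n).
Local Open Scope ereal_scope.

(* The Hahn decomposition is the one that [charge_integral] picks. *)
Definition hahn_pair (i : 'I_n) := projT2 (cid (exists_hahn_decomposition (Du i))).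

Definition component_variation (i : 'I_n) : set 'rV[R]_n -> \bar R :=
  charge_variation (hahn_pair i).

HB.instance Definition _ i := Measure.on (component_variation i).

Let component_variation_fin i : fin_num_fun (component_variation i).
Proof. by move=> A mA; rewrite /component_variation fin_num_measure. Qed.

HB.instance Definition _ i :=
  Measure_isFinite.Build _ _ _ (component_variation i) (component_variation_fin i).

Lemma coord_le_euclid_norm (v : 'rV[R]_n) i : (`|v ord0 i| <= euclid_norm v)%R.
Proof.
rewrite -sqrtr_sqr ler_sqrt; last by apply: sumr_ge0 => j _; exact: sqr_ge0.
by rewrite (bigD1 i)//= lerDl; apply: sumr_ge0 => j _; exact: sqr_ge0.
Qed.

(** A crude comparison, from n (d/(n+1))^2 < d^2: any cube inside the Euclidean ball will do, and
    n+1 never vanishes. *)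
Lemma euclid_norm_lt (v : 'rV[R]_n) d : (`|v| < d / n.+1%:R)%R -> (euclid_norm v < d)%R.
Proof.
move=> vd; have d0 : (0 < d)%R.
  by have := le_lt_trans (normr_ge0 v) vd; rewrite pmulr_lgt0// invr_gt0.
rewrite -[ltRHS]gtr0_norm// -sqrtr_sqr ltr_sqrt ?exprn_gt0//.
apply: (@le_lt_trans _ _ (\sum_(i < n) (d / n.+1%:R) ^+ 2)%R).
  apply: ler_sum => i _; rewrite -real_normK ?num_real// lerXn2r ?nnegrE//.
    by rewrite divr_ge0// ltW.
  by rewrite (le_trans (rV_coord_le_norm v i))// ltW.
rewrite sumr_const card_ord expr_div_n -mulrnAr gtr_pMr ?exprn_gt0//.
rewrite -mulr_natl ltr_pdivrMr ?exprn_gt0// mul1r -natrX ltr_nat.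
by rewrite -mulnn mulSn addSn ltnS leq_addr.
Qed.

(** The variation of D_i u on E is attained on the two pieces of a Hahn decomposition. Completed by
    empty sets they form a partition of E that competes in [vector_variation], and a coordinate is
    at most the Euclidean norm. *)
Lemma component_variation_le i E : measurable E ->
  component_variation i E <= vector_variation Du E.
Proof.
move=> mE; rewrite /component_variation /hahn_pair; case: (cid _) => -[P N] /= HD; have [[mP _] [mN _] PNT PN0] := HD.
pose F (k : nat) := if k is 0%N then E `&` P else if k is 1%N then E `&` N else set0.
apply: (@le_trans _ _ (\sum_(k <oo) (euclid_norm (vector_value Du (F k)))%:E)); last first.
  apply: ereal_sup_ubound; exists F => //; split.
  - by case=> [|[|k]] /=; [exact: measurableI|exact: measurableI|exact: measurable0].
  - apply/trivIsetP => -[|[|k]] [|[|l]] _ _ //= _; rewrite ?setI0 ?set0I//.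
      by rewrite setIACA PN0 setI0.
    by rewrite setIACA (setIC N) PN0 setI0.
  - apply/seteqP; split => [x [[|[|k]] _ []]//|x Ex].
    have : (P `|` N) x by rewrite PNT.
    by case=> ?; [exists 0%N|exists 1%N].
apply: le_trans (@nneseries_lim_ge _ _ _ 0%N 2 _); last first.
  by move=> k _ _; rewrite lee_fin sqrtr_ge0.
rewrite big_nat_recr//= big_nat1.
have val A : measurable A -> `|Du i A| <= (euclid_norm (vector_value Du A))%:E.
  move=> mA; rewrite -(fineK (fin_num_measure (Du i) A mA)) /= lee_fin.
  by have := coord_le_euclid_norm (vector_value Du A) i; rewrite mxE.
apply: leeD.
  apply: le_trans (val _ (measurableI _ _ mE mP)).
  rewrite jordan_posE charge.cjordan_posE /crestr0 mem_set//=.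
  exact: lee_abs.
apply: le_trans (val _ (measurableI _ _ mE mN)).
rewrite jordan_negE charge.cjordan_negE /crestr0 mem_set//=.
by rewrite -abseN; exact: lee_abs.
Qed.

Lemma component_translation_estimate (u : 'rV[R]_n -> R) (i : 'I_n) :
  leb.-integrable setT (EFin \o u) -> distributional_gradient u Du ->
  forall s t E, (s <= t)%R -> measurable E ->
  \int[leb]_(y in E) `|u (y + t *: basis_vector i)%R - u (y + s *: basis_vector i)%R|%:E <=
  \int[@lebesgue_measure R]_(r in `[s, t])
    component_variation i [set y | E (y - r *: basis_vector i)%R].
Proof.
move=> iu du s t E st mE.
exact: (translation_estimate (p := jordan_pos (hahn_pair i)) (q := jordan_neg (hahn_pair i))
  iu (du i) st mE).
Qed.

End variation.

(** * Monotonicity of the integral and the blow-up set *)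

Section monotone_integral.
Context d (T : measurableType d) (R : realType) (mu : {measure set T -> \bar R}).
Local Open Scope ereal_scope.

(* No measurability: the integral of a non-negative function is a supremum over
   the simple functions below it. *)
Lemma ge0_le_integral_nonmeasurable (A B : set T) (f g : T -> \bar R) :
  (forall x, 0 <= f x) -> (forall x, f x <= g x) -> A `<=` B ->
  \int[mu]_(x in A) f x <= \int[mu]_(x in B) g x.
Proof.
move=> f0 fg AB; rewrite [leLHS]integral_mkcond [leRHS]integral_mkcond.
have fg' x : (f \_ A) x <= (g \_ B) x.
  rewrite !patchE; case: ifPn => xA; first by rewrite ifT//; move: xA; rewrite !inE; exact: AB.
  by case: ifPn => // _; exact: le_trans (fg x).
have f0' x : 0 <= (f \_ A) x by rewrite patchE; case: ifP.
rewrite !ge0_integralTE//; last by move=> x; exact: le_trans (fg' x).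
apply: le_ereal_sup => _ [h hf <-]; exists h => // x.
exact: le_trans (hf x) (fg' x).
Qed.

End monotone_integral.

Section blowup.
Context {R : realType} {n : nat}.
Local Open Scope ereal_scope.

(** A lower limit is a supremum of infima over neighbourhoods; the positive numbers are a right
    neighbourhood of 0, so when the lower limit is finite, so is the infimum over all d > 0. *)
Lemma not_blowup_lty (g : 'rV[R]_n -> \bar R) x : ~ blowup_set g x ->
  exists2 d : R, (0 < d)%R & \int[lebesgue_rV R n]_(y in euclid_ball x d) g y < +oo.
Proof.
rewrite /blowup_set /= limf_einfE => /eqP; rewrite -ltey => supoo.
have : ereal_inf [set \int[lebesgue_rV R n]_(y in euclid_ball x d) g y | d in [set d : R | (0 < d)%R]] < +oo.
  apply: le_lt_trans supoo; apply: ereal_sup_ubound.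
  by exists [set d : R | (0 < d)%R] => //; exact: nbhs_right_gt.
by case/ereal_inf_lt => _ [d d0 <-] ?; exists d.
Qed.

Lemma ball_sub_euclid_ball (x : 'rV[R]_n) d : (0 < d)%R ->
  ball x (d / n.+1%:R)%R `<=` euclid_ball x d.
Proof.
move=> d0 y; rewrite mx_norm_ball /ball_ /= distrC => yd.
rewrite /euclid_ball /=.
apply: euclid_norm_lt.
exact: yd.
Qed.

End blowup.

(** * The weak derivative of the maximal function *)

Section maximal_derivative.
Context {R : realType} {n : nat} (k : maximal_kind).
Variables (u : 'rV[R]_n -> R) (Du : vector_measure R n).
Local Open Scope ereal_scope.
Local Notation mu := (@lebesgue_measure R).
Local Notation g j := (maximal_measure k (component_variation Du j)).
Local Notation f := (maximal_fun k u).
Local Notation e j := (basis_vector j : 'rV[R]_n).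
Hypotheses (iu : leb.-integrable setT (EFin \o u)) (du : distributional_gradient u Du).

(** The cut-off is by the maximal function of the i-th component: it controls M u in the direction
    e_i and, coming from a finite measure, is measurable and of weak type. *)
Definition maximal_partial (i : 'I_n) : 'rV[R]_n -> R :=
  line_derivative (fine \o f) (g i) (e i).

Let mabsu : measurable_fun setT (fun x => `|u x|%:E).
Proof. by apply/measurable_EFinP; apply: measurableT_comp => //; move/integrableP : iu => [/measurable_EFinP]. Qed.

Let absu0 x : 0 <= `|u x|%:E. Proof. by []. Qed.

(** M u is by conversion the maximal function of the measure with density |u|, so the results on
    measures apply, here and in [foo]. *)
Let mf : measurable_fun setT f.
Proof. exact: (measurable_maximal k (density leb mabsu absu0)). Qed.

Let f0 x : 0 <= f x.
Proof. by apply: maximal_ge0 => A; exact: integral_ge0. Qed.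

Let foo : {ae leb, forall x, f x < +oo}.
Proof.
apply: (maximal_ae_lty k (mu := density leb mabsu absu0)).
by move/integrableP : iu => [].
Qed.

Let mg j : measurable_fun setT (g j).
Proof. exact: measurable_maximal. Qed.

Let g0 j x : 0 <= g j x.
Proof. exact: maximal_ge0. Qed.

Lemma maximal_component_le j x : g j x <= maximal_measure k (vector_variation Du) x.
Proof.
apply: le_maximal => c r r0; apply: component_variation_le.
exact: measurable_ball_rV.
Qed.

Lemma maximal_partial_le i x :
  `|maximal_partial i x|%:E <= maximal_measure k (vector_variation Du) x.
Proof.
exact: le_trans (line_derivative_le (fine \o f) (e i) (@g0 i) x) (maximal_component_le i x).
Qed.

Lemma measurable_maximal_partial i : measurable_fun setT (maximal_partial i).
Proof.
apply: measurable_line_derivative => //.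
exact: measurableT_comp (fine_measurable measurableT) mf.
Qed.

Lemma maximal_partial_weak_L1 i : weak_L1 (maximal_partial i).
Proof.
split; first exact: measurable_maximal_partial.
apply: (@le_lt_trans _ _ ((3 ^+ n)%:E * component_variation Du i setT)); last first.
  by rewrite lte_mul_pinfty// -ge0_fin_numE// fin_num_measure.
apply: ge_ereal_sup => _ [t t0 <-].
apply: le_trans (maximal_weak_type k (component_variation Du i) t0).
apply: lee_wpmul2l; first by rewrite lee_fin ltW.
apply: le_measure; rewrite ?inE.
- rewrite -[X in measurable X]setTI.
  rewrite (_ : [set x | _] = (fun x => `|maximal_partial i x|%R) @^-1` `]t, +oo[%classic).
    have mh : measurable_fun setT (fun x => `|maximal_partial i x|%R).
      by apply: measurableT_comp => //; exact: measurable_maximal_partial.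
    by apply: mh => //; exact: measurable_itv.
  by apply/seteqP; split => x /=; rewrite in_itv/= andbT.
- exact: measurable_maximal_gt.
- move=> x /= tx; apply: lt_le_trans (line_derivative_le (fine \o f) (e i) (@g0 i) x).
  by rewrite lte_fin.
Qed.

Let near_good x : ~ blowup_set (maximal_measure k (vector_variation Du)) x ->
  exists2 r : R, (0 < r)%R & (forall j, \int[leb]_(y in ball x r) g j y < +oo) /\
    \int[leb]_(y in ball x r) f y < +oo.
Proof.
move=> /not_blowup_lty[d d0 doo].
have goo j : \int[leb]_(y in ball x (d / n.+1%:R)%R) g j y < +oo.
  apply: le_lt_trans doo; apply: ge0_le_integral_nonmeasurable => //.
    exact: maximal_component_le.
  exact: ball_sub_euclid_ball.
(* A third, because [ball_integral_lty] asks for the g_j on a cube of triple radius. *)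
have r0 : (0 < d / n.+1%:R / 3)%R by rewrite !divr_gt0.
exists (d / n.+1%:R / 3)%R; first exact: r0.
split.
  move=> j; apply: le_lt_trans (goo j); apply: ge0_le_integral_nonmeasurable => //.
  by apply: le_ball; rewrite ler_pdivrMr// ler_peMr ?divr_ge0 ?ltW// ltr1n.
have dn (j : 'I_n) := component_translation_estimate j iu du.
apply: (ball_integral_lty mf f0 foo mg g0 _ _ r0).
- by move=> j y s t st; exact: (maximal_line k iu (dn j)).
- by move=> j y s t st; exact: (maximal_line_rev k iu (dn j)).
- move=> j; rewrite (_ : _ + _ = d / n.+1%:R)%R//.
  by field.
Qed.

Lemma maximal_partial_by_parts i (phi : 'rV[R]_n -> R) : test_function phi ->
  supp phi `&` blowup_set (maximal_measure k (vector_variation Du)) = set0 ->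
  [/\ leb.-integrable setT (fun x => f x * (partial i phi x)%:E),
      leb.-integrable setT (fun x => (maximal_partial i x * phi x)%:E) &
      - (\int[leb]_x (f x * (partial i phi x)%:E)) =
      \int[leb]_x (maximal_partial i x * phi x)%:E].
Proof.
move=> tphi phiA.
have mf' : measurable_fun setT (fine \o f).
  exact: measurableT_comp (fine_measurable measurableT) mf.
have f'g x s t : (s <= t)%R ->
    `|(fine \o f) (x + t *: e i)%R - (fine \o f) (x + s *: e i)%R|%:E <=
    \int[mu]_(r in `[s, t]) g i (x + r *: e i)%R.
  exact: (fine_maximal_line k iu (component_translation_estimate i iu du)).
have loc x : supp phi x -> exists2 r : R, (0 < r)%R &
    \int[leb]_(y in ball x r) g i y < +oo /\
    \int[leb]_(y in ball x r) `|(fine \o f) y|%:E < +oo.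
  move=> xK; have [|r r0 [goo fo]] := @near_good x.
    by move=> xA; rewrite -[False]/(set0 x) -phiA.
  exists r; first exact: r0.
  split; first exact: goo.
  apply: le_lt_trans fo.
  apply: ge0_le_integral_nonmeasurable => // y.
  by rewrite /= ger0_norm ?fine_ge0//; case: (f y) (f0 y) => //= *; rewrite leey.
have [if' ih' eq'] := local_integral_by_parts mf' (mg i) (@g0 i) f'g tphi loc.
(* Integration by parts was carried out for the real-valued [fine \o f]; M u is finite almost
   everywhere, so integrability and integrals transfer to M u. *)
have ff' : {ae leb, forall x, setT x ->
    ((fine \o f) x * partial i phi x)%:E = f x * (partial i phi x)%:E}.
  apply: (@filterS _ _ (ae_filter_ringOfSetsType leb) _ _ _ foo) => x fx _ /=.
  by rewrite EFinM fineK// ge0_fin_numE.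
have mfphi : measurable_fun setT (fun x => f x * (partial i phi x)%:E).
  apply: emeasurable_funM => //; apply/measurable_EFinP.
  exact: measurable_test_function (test_function_partial i tphi).
have mf'phi : measurable_fun setT (fun x => ((fine \o f) x * partial i phi x)%:E).
  exact: measurable_int if'.
split => //.
  apply/integrableP; split => //.
  have absE : ae_eq leb setT (fun x => `|((fine \o f) x * partial i phi x)%:E|)
      (fun x => `|f x * (partial i phi x)%:E|).
    by apply: (@filterS _ _ (ae_filter_ringOfSetsType leb) _ _ _ ff') => x h /h ->.
  have mabs (F : 'rV[R]_n -> \bar R) : measurable_fun setT F -> measurable_fun setT (fun x => `|F x|).
    by move=> mF; exact: measurableT_comp.
  rewrite -(ae_eq_integral _ _ measurableT (mabs _ mf'phi) (mabs _ mfphi) absE).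
  by move/integrableP : if' => [].
by rewrite -(ae_eq_integral _ _ measurableT mf'phi mfphi ff').
Qed.

End maximal_derivative.

Local Open Scope ereal_scope.

Theorem corollary4p2 (R : realType) (n : nat) (n_gt1 : (1 < n)%N) :
  exists C : R,
  forall (k : maximal_kind) (u : 'rV[R]_n -> R) (Du : vector_measure R n),
  BV u -> distributional_gradient u Du ->
  let L := lebesgue_rV R n in
  let MDu := maximal_measure k (vector_variation Du) in
  let A := blowup_set MDu in
  forall i : 'I_n, exists h : 'rV[R]_n -> R,
  [/\ weak_L1 h,
      forall phi : 'rV[R]_n -> R, test_function phi -> supp phi `&` A = set0 ->
        [/\ L.-integrable [set: 'rV[R]_n]
              (fun x => maximal_fun k u x * (partial i phi x)%:E),
            L.-integrable [set: 'rV[R]_n] (fun x => (h x * phi x)%:E) &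
            - (\int[L]_x (maximal_fun k u x * (partial i phi x)%:E)) =
            \int[L]_x (h x * phi x)%:E] &
      {ae L, forall x, `|h x|%:E <= C%:E * MDu x}].
Proof.
exists 1%R => k u Du [iu _] du L MDu A i.
exists (maximal_partial k u Du i); split.
- exact: maximal_partial_weak_L1.
- by move=> phi tphi phiA; exact: maximal_partial_by_parts.
- by apply: aeW => x; rewrite mul1e; exact: maximal_partial_le.
Qed.
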